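(* Suppose $\Gamma$ is a finite topological graph and $f\colon\Gamma\to\Gamma$ is a regular topological graph-map that is expanding on all scales. Choose an orientation on $\Gamma$ and an ordering $E_+\Gamma=\{e_1,\dots,e_n\}$. Then the topological graph-map $f$ is expanding, the matrix $A(f)$ is irreducible with Perron–Frobenius eigenvalue $\lambda=\lambda(f)>1$, and there exists a unique volume-$1$ metric structure $\mathcal L$ on $\Gamma$ with the following properties: (1) $f\colon\Gamma\to\Gamma$ is linear with respect to $\mathcal L$; (2) $f$ is a local $\lambda$-homothety, meaning that the norm of the derivative of $f$ at every point of $\Gamma\setminus f^{-1}(V\Gamma)$ is $\lambda$; and (3) for every $i=1,\dots,n$ the $d_{\mathcal L}$-length of $e_i$ is equal to $v_i$, where $\mathbf v=(v_1,\dots,v_n)^T$ is the Perron–Frobenius eigenvector of $A(f)$ acting on the left on column vectors ($A(f)\mathbf v=\lambda\mathbf v$), normalized by $\sum_{i=1}^nv_i=1$.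
   Context: A topological graph $\Gamma$ is a locally finite $1$-dimensional cell complex, with vertex set $V\Gamma$ and set $E\Gamma$ of oriented edges (open $1$-cells with an orientation); $e^{-1}$ is $e$ reversed, $o(e),t(e)$ are the initial and terminal vertices. An orientation is a choice $E_+\Gamma\subset E\Gamma$ of exactly one of $e,e^{-1}$ for each edge. An edge-path is a sequence $e_1\cdots e_n$ with $t(e_i)=o(e_{i+1})$, of length $n$ denoted $|\cdot|$; it is tight if it has no subpath $ee^{-1}$, nondegenerate if $n\ge1$. A topological graph-map $f\colon\Gamma\to\Gamma$ is a continuous map with $f(V\Gamma)\subseteq V\Gamma$ such that each edge $e$ either is sent to a vertex or can be subdivided into finitely many intervals each mapped homeomorphically onto an open edge; the resulting edge-path is $f(e)$. $f$ is regular if each $f(e)$ is nondegenerate and tight, and expanding if $|f^n(e)|\to\infty$ as $n\to\infty$ for every $e$. $f$ is expanding on all scales if for every $x\in\Gamma$, every neighborhood $U$ of $x$, and every edge $e$ of $\Gamma$, there exist a positive integer $m$ and an open interval $W\subset U$ such that $f^m$ maps $W$ homeomorphically onto $e$. The transition matrix $A(f)$ has $(i,j)$ entry the number of occurrences of $e_j^{\pm1}$ in $f(e_i)$; it is irreducible if for all $i,j$ some power $A(f)^t$, $t\ge1$, has positive $(i,j)$ entry; $\lambda(f)$ is its spectral radius. A metric structure $\mathcal L$ on $\Gamma$ is a choice of identification of each edge with an interval of some positive length $\mathcal L(e)=\mathcal L(e^{-1})$ up to isometry (i.e. characteristic maps $[a,b]\to\Gamma$ with $b-a=\mathcal L(e)$,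 well defined up to isometric reparametrization); $d_{\mathcal L}$ is the induced geodesic (path) metric on components. Its volume is $\sum_{e\in E_+\Gamma}\mathcal L(e)$. $f$ is linear with respect to $\mathcal L$ if on each subinterval of an edge mapped homeomorphically onto an edge, $f$ is affine in these coordinates. *)

(* Defs.v *)
From HB Require Import structures.
From mathcomp Require Import all_boot all_order all_algebra.
From mathcomp Require Import all_classical all_reals all_analysis.
From mathcomp Require Import complex.
Set Implicit Arguments.
Unset Strict Implicit.
Unset Printing Implicit Defensive.
Import Order.TTheory GRing.Theory Num.Theory.
Import numFieldNormedType.Exports.
Local Open Scope classical_set_scope.
Local Open Scope ring_scope.

(* f restricts to a homeomorphism from A onto B, both with the subspace
   topology; the values of f and of the inverse g off A and B are junk. *)
Definition homeo_on (S T : topologicalType) (A : set S) (B : set T)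
    (f : S -> T) : Prop :=
  [/\ f @` A = B, {within A, continuous f} &
      exists g : T -> S,
        {within B, continuous g} /\ forall x, A x -> g (f x) = x].

(* phi, on [a, b], is a characteristic map of the open 1-cell C of a complex
   with vertex set V. *)
Definition char_map (R : realType) (X : topologicalType) (V C : set X)
    (a b : R) (phi : R -> X) : Prop :=
  [/\ {within `[a, b], continuous phi}, homeo_on `]a, b[ C phi,
      V (phi a) & V (phi b)].

(* A finite 1-dimensional cell complex. gedge is the set of ORIENTED edges and
   ginv is e |-> e^-1; gchar e is some characteristic map of e, running from
   o(e) = gchar e 0 to t(e) = gchar e 1. Only its image and its direction are
   used below, so the choice of parametrization is immaterial. As there are
   finitely many cells, Hausdorff plus these axioms force the cell complex
   (weak) topology. Loops, multiple edges and disconnected graphs are allowed;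
   being 1-dimensional, the complex has at least one 1-cell. *)
Record tgraph (R : realType) := TGraph {
  gspace :> topologicalType;
  gvert : set gspace;
  gedge : finType;
  ginv : gedge -> gedge;
  gchar : gedge -> R -> gspace;
  ghausdorff : hausdorff_space gspace;
  gvert_finite : finite_set gvert;
  gedge_gt0 : (0 < #|gedge|)%N;
  ginvK : involutive ginv;
  ginv_neq : forall e, ginv e != e;
  gcharP : forall e, char_map gvert (gchar e @` `]0, 1[) 0 1 (gchar e);
  gchar_inv : forall e t, 0 <= t <= 1 -> gchar (ginv e) t = gchar e (1 - t);
  gcover : forall x, gvert x \/ exists e, (gchar e @` `]0, 1[) x;
  gvert_cell : forall e x, gvert x -> ~ (gchar e @` `]0, 1[) x;
  gcell_disj : forall e e' x, (gchar e @` `]0, 1[) x ->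
    (gchar e' @` `]0, 1[) x -> e' = e \/ e' = ginv e
}.

Section Maps.
Variables (R : realType) (G : tgraph R).
Implicit Types (e : gedge G) (f : G -> G).

Definition cell e : set G := gchar e @` `]0, 1[.

(* x comes before y on the open edge e with its orientation. *)
Definition cell_lt e (x y : G) : Prop :=
  exists s t : R, [/\ 0 < s, s < t, t < 1, gchar e s = x & gchar e t = y].

(* f maps the subinterval ]s, t[ of e homeomorphically onto the open edge e',
   respecting the orientations of e and e'. *)
Definition maps_onto_edge f e (s t : R) e' : Prop :=
  homeo_on (gchar e @` `]s, t[) (cell e') f /\
  forall u w, s < u -> u < w -> w < t ->
    cell_lt e' (f (gchar e u)) (f (gchar e w)).

(* p is the edge-path f(e): either e is sent to a vertex and p is empty, or e is
   subdivided at 0 = t_0 < ... < t_n = 1 into intervals mapped successively onto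
   the edges of p. By continuity consecutive edges of p then match up:
   t(p_i) = o(p_(i+1)). *)
Definition edge_image f e (p : seq (gedge G)) : Prop :=
  (p = [::] /\ exists2 v, gvert v & forall x, cell e x -> f x = v) \/
  exists t : nat -> R,
    [/\ t 0%N = 0, t (size p) = 1 &
        forall i, (i < size p)%N ->
          t i < t i.+1 /\ maps_onto_edge f e (t i) (t i.+1) (nth e p i)].

Definition graph_map f : Prop :=
  [/\ continuous f, forall x, gvert x -> gvert (f x) &
      forall e, exists p, edge_image f e p].

(* The edge-path f(e); edge_image f e has exactly one element when f is a
   topological graph-map, so the default value is irrelevant. *)
Definition epath f e : seq (gedge G) := xget [::] [set p | edge_image f e p].

Definition tight (p : seq (gedge G)) : bool :=
  sorted [rel e e' | e' != ginv e] p.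

Definition regular_map f : Prop :=
  forall e, (0 < size (epath f e))%N /\ tight (epath f e).

Definition expanding f : Prop :=
  forall e, size (epath (iter k f) e) @[k --> \oo] --> \oo.

Definition open_interval (W : set G) : Prop :=
  exists g : R -> G, homeo_on `](0 : R), 1[ W g.

Definition expanding_on_all_scales f : Prop :=
  forall (x : G) (U : set G) e, nbhs x U ->
    exists (m : nat) (W : set G),
      [/\ (0 < m)%N, open_interval W, W `<=` U &
          homeo_on W (cell e) (iter m f)].

Definition orientation (Ep : {set gedge G}) : Prop :=
  forall e, (e \in Ep) (+) (ginv e \in Ep).

Definition transition_matrix f n (e_ : 'I_n -> gedge G) : 'M[R]_n :=
  \matrix_(i, j)
    (count [pred e | (e == e_ j) || (e == ginv (e_ j))] (epath f (e_ i)))%:R.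

End Maps.

Section PerronFrobenius.
Variables (R : realType) (n : nat).
Implicit Type A : 'M[R]_n.

Definition irreducible_mx A : Prop :=
  forall i j, exists t : nat, (0 < t)%N /\ 0 < (A ^+ t) i j.

Definition spectral_radius A : R :=
  sup [set Normc.normc z | z in
        [set z : R[i] | eigenvalue (map_mx (real_complex R) A) z]].

Definition PF_eigenvector A (v : 'cV[R]_n) : Prop :=
  [/\ forall i, 0 < v i 0, A *m v = spectral_radius A *: v &
      \sum_i v i 0 = 1].

End PerronFrobenius.

(* phi on [a, b] is psi on [a', b'] precomposed with an isometry, possibly
   orientation reversing, of [a, b] onto [a', b']. *)
Definition isom_reparam (R : realType) (X : Type) (a b : R) (phi : R -> X)
    (a' b' : R) (psi : R -> X) : Prop :=
  exists h : R -> R,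
    [/\ forall s t, s \in `[a, b] -> t \in `[a, b] ->
          `|h s - h t| = `|s - t|,
        h @` `[a, b] = `[a', b']%classic &
        forall s, s \in `[a, b] -> phi s = psi (h s)].

(* A representative of a metric structure: a chart for each edge, with the same
   chart up to isometry for e and e^-1 (so L(e) = L(e^-1)). Metric structures
   proper are the classes of representatives for ms_equiv. *)
Record metric_structure (R : realType) (G : tgraph R) := MetricStructure {
  ms_lo : gedge G -> R;
  ms_hi : gedge G -> R;
  ms_chart : gedge G -> R -> G;
  ms_lt : forall e, ms_lo e < ms_hi e;
  ms_chartP : forall e,
    char_map (@gvert R G) (cell e) (ms_lo e) (ms_hi e) (ms_chart e);
  ms_inv : forall e, isom_reparam (ms_lo e) (ms_hi e) (ms_chart e)
    (ms_lo (ginv e)) (ms_hi (ginv e)) (ms_chart (ginv e))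
}.

Section Metric.
Variables (R : realType) (G : tgraph R).
Implicit Types (L : metric_structure G) (e : gedge G) (f : G -> G).

Definition ms_equiv L L' : Prop :=
  forall e, isom_reparam (ms_lo L e) (ms_hi L e) (ms_chart L e)
    (ms_lo L' e) (ms_hi L' e) (ms_chart L' e).

Definition ms_length L e : R := ms_hi L e - ms_lo L e.

Definition volume L (Ep : {set gedge G}) : R := \sum_(e in Ep) ms_length L e.

(* The coordinate, in the chart of e, of a point of the open edge e (0 off e). *)
Definition ms_coord L e (x : G) : R :=
  xget 0 [set s | (s \in `]ms_lo L e, ms_hi L e[) /\ ms_chart L e s = x].

Definition linear_wrt L f : Prop :=
  forall e e' (c d : R), ms_lo L e <= c -> c < d -> d <= ms_hi L e ->
    homeo_on (ms_chart L e @` `]c, d[) (cell e') f ->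
    exists al be : R, forall s, s \in `]c, d[ ->
      ms_coord L e' (f (ms_chart L e s)) = al * s + be.

(* A point off f^-1(V) is off V for a graph-map f, hence of the form
   ms_chart L e s. *)
Definition local_homothety L f (lam : R) : Prop :=
  forall e e' (s : R), s \in `]ms_lo L e, ms_hi L e[ ->
    cell e' (f (ms_chart L e s)) ->
    let F := fun u : R => ms_coord L e' (f (ms_chart L e u)) in
    derivable F s 1 /\ `|F^`()%classic s| = lam.

(* p = (e_1,s_1,t_1),..,(e_k,s_k,t_k) is a piecewise linear path from x to y, its
   i-th piece running along the closed edge e_i between coordinates s_i, t_i. *)
Fixpoint ms_path L (x : G) (p : seq (gedge G * R * R)) (y : G) : Prop :=
  match p with
  | [::] => x = y
  | (e, s, t) :: q =>
      [/\ s \in `[ms_lo L e, ms_hi L e], t \in `[ms_lo L e, ms_hi L e],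
          ms_chart L e s = x & ms_path L (ms_chart L e t) q y]
  end.

Definition ms_path_length (p : seq (gedge G * R * R)) : R :=
  \sum_(q <- p) `|q.2 - q.1.2|.

(* The path metric d_L; it is +oo between distinct components. *)
Definition ms_dist L (x y : G) : \bar R :=
  ereal_inf [set (ms_path_length p)%:E | p in [set p | ms_path L x p y]].

(* The length of the edge e as a curve in the metric space (G, d_L). *)
Definition dist_length L e : \bar R :=
  let pt s i := ms_chart L e (nth 0 (ms_lo L e :: s) i) in
  ereal_sup
    [set (\sum_(i < size s) ms_dist L (pt s i) (pt s i.+1))%E
      | s in itv_partition (ms_lo L e) (ms_hi L e)].

End Metric.

(* Main.v *)
Require Import Defs.
From HB Require Import structures.
From mathcomp Require Import all_boot all_order all_algebra.
From mathcomp Require Import all_classical all_reals all_analysis.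
From mathcomp Require Import complex ring lra.
Set Implicit Arguments.
Unset Strict Implicit.
Unset Printing Implicit Defensive.
Import Order.TTheory GRing.Theory Num.Theory.
Import numFieldNormedType.Exports.
Local Open Scope classical_set_scope.
Local Open Scope ring_scope.

(** Since [f] is expanding on all scales, every open subinterval of an edge [e]
    contains a whole interval of the subdivision of [e] defined by some [f^m], and
    the edge it is mapped onto can be prescribed. This makes [A(f)] irreducible, and
    some [f(e)] has length at least 2, as otherwise all powers of [f] would be
    injective on edges; hence [f] is expanding and [lambda > 1].

    Let [l(e)] be the entry of the Perron-Frobenius eigenvector at [e]. The
    coordinates [D_e : e -> [0, l(e)]] for which [f] stretches by [lambda] are the
    fixed point of an operator which contracts by [1 / lambda]: on the [i]-th
    subinterval, mapped onto [e_i], [D_e] is [D_e] at its origin plus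
    [D_(e_i) o f / lambda]. The consistency of the end values is
    [A(f) v = lambda v]. The coordinate [D_e] is strictly increasing because every
    interval contains a whole subdivision interval of some [f^m], so its inverse is
    a chart. Conversely the charts of any metric structure as in the theorem solve
    the same fixed point equation. *)

(** * Increasing homeomorphisms of intervals *)

(** All the analysis takes place in the parameter interval [[0, 1]] of each edge. A homeomorphism
    onto an edge becomes a monotone real function extended by constants, so that refining
    subdivisions is composition and the operator with fixed point [D] is a single sum over the edges
    of [f(e)]. The hypothesis on scales speaks of arbitrary intervals [W], unrelated to any
    subdivision and mapped in either direction; they have to be matched with exact subdivision
    intervals before anything can be counted or measured. Direction is the other recurrent
    difficulty: [e] and its inverse need compatible charts, and the charts of a competing metric
    structure may run backwards. The first is settled by uniqueness of the fixed point, the second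
    by a sign. Finally, the length in property (3) is that of a curve in the path metric, where
    other edges may give shortcuts between the ends of [e]; a Lipschitz function centred at the
    midpoint of [e] shows that nothing is lost. *)

Section Ramps.
Variable R : realType.
Implicit Types (g h s : R -> R) (a b c x y u w L : R).

(** A monotone function has at most jump discontinuities, and a jump would leave out values of
    [[a, b]]. Continuity of clamps, inverses and extensions below is obtained this way. *)
Lemma mono_surj_continuous a b g :
  {homo g : x y / x <= y} -> (forall x, a <= g x <= b) ->
  (forall y, a <= y <= b -> exists x, g x = y) -> continuous g.
Proof.
move=> g_homo g_rng g_surj x; apply/cvgrPdist_le => /= e e0.
have /andP[ag gb] := g_rng x.
have lower : \forall u \near x, g x - e <= g u.
  have [ga|ga] := leP (g x - e) a.
    by near=> u; have /andP[] := g_rng u; lra.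
  have [z zE] : exists z, g z = g x - e by apply: g_surj; lra.
  have zx : z < x by rewrite ltNge; apply/negP => /g_homo; lra.
  have := @lt_nbhsr R z x zx; apply: filterS => u zu; rewrite -zE.
  exact/g_homo/ltW.
have upper : \forall u \near x, g u <= g x + e.
  have [ga|ga] := leP b (g x + e).
    by near=> u; have /andP[] := g_rng u; lra.
  have [z zE] : exists z, g z = g x + e by apply: g_surj; lra.
  have zx : x < z by rewrite ltNge; apply/negP => /g_homo; lra.
  have := @lt_nbhsl R x z zx; apply: filterS => u zu; rewrite -zE.
  exact/g_homo/ltW.
apply: filterS2 lower upper => u lo up; rewrite ler_norml; lra.
Unshelve. all: by end_near. Qed.

Definition clamp a b u : R := Num.min (Num.max u a) b.

Lemma clamp_id a b u : a <= u <= b -> clamp a b u = u.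
Proof. by move=> /andP[au ub]; rewrite /clamp max_l // min_l. Qed.

Lemma clamp_lo a b u : a <= b -> u <= a -> clamp a b u = a.
Proof. by move=> ab ua; rewrite /clamp max_r // min_l. Qed.

Lemma clamp_hi a b u : a <= b -> b <= u -> clamp a b u = b.
Proof. by move=> ab bu; rewrite /clamp max_l ?min_r // (le_trans ab). Qed.

Lemma clamp_range a b u : a <= b -> a <= clamp a b u <= b.
Proof.
by move=> ab; rewrite /clamp le_min ge_min ab le_max !lexx !orbT.
Qed.

Lemma clamp_homo a b : a <= b -> {homo clamp a b : x y / x <= y}.
Proof.
move=> ab x y xy.
have [xa|ax] := leP x a.
  by rewrite (clamp_lo ab xa); have /andP[] := clamp_range y ab.
have [by_|yb] := leP b y.
  by rewrite (clamp_hi ab by_); have /andP[] := clamp_range x ab.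
by rewrite !clamp_id //; lra.
Qed.

Lemma clamp_continuous a b : a <= b -> continuous (clamp a b).
Proof.
move=> ab; apply: (@mono_surj_continuous a b).
- exact: clamp_homo.
- by move=> x; exact: clamp_range.
- by move=> y yab; exists y; exact: clamp_id.
Qed.

(* An increasing homeomorphism of [a, c] onto [0, L], extended by constants so
   that continuity and composition make sense on all of R. *)
Definition ramp a c L g : Prop :=
  [/\ {homo g : x y / x <= y}, forall u, u <= a -> g u = 0,
      forall u, c <= u -> g u = L,
      forall u w, a <= u -> u < w -> w <= c -> g u < g w & continuous g].

Lemma ramp_range a c L g : ramp a c L g -> 0 <= L -> forall u, 0 <= g u <= L.
Proof.
case=> g_homo g0 gL _ _ L0 u.
have [ua|/ltW au] := leP u a.
  by rewrite (g0 _ ua) lexx.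
have [cu|/ltW uc] := leP c u.
  by rewrite (gL _ cu) lexx L0.
by rewrite -(g0 _ (lexx a)) -(gL _ (lexx c)) !g_homo.
Qed.

Lemma ramp_gt0 a c L g : ramp a c L g -> a < c -> 0 < L.
Proof.
case=> _ g0 gL g_incr _ ac.
by rewrite -(g0 _ (lexx a)) -(gL _ (lexx c)) g_incr.
Qed.

Lemma ramp_inj a c L g : ramp a c L g ->
  forall u w, a <= u <= c -> a <= w <= c -> g u = g w -> u = w.
Proof.
case=> _ _ _ g_incr _ u w /andP[au uc] /andP[aw wc] guw.
have [uw|wu|//] := ltgtP u w.
  by have := g_incr _ _ au uw wc; rewrite guw ltxx.
by have := g_incr _ _ aw wu uc; rewrite guw ltxx.
Qed.

Lemma ramp_inner a c L g : ramp a c L g ->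
  forall u, a < u < c -> 0 < g u < L.
Proof.
case=> _ g0 gL g_incr _ u /andP[au uc].
by rewrite -(g0 _ (lexx a)) -(gL _ (lexx c)) !g_incr // ltW.
Qed.

Lemma ramp_inner_inv a c L g : ramp a c L g ->
  forall u, 0 < g u < L -> a < u < c.
Proof.
case=> _ g0 gL _ _ u /andP[gu0 guL]; apply/andP; split.
  by rewrite ltNge; apply/negP => /g0 gu; rewrite gu ltxx in gu0.
by rewrite ltNge; apply/negP => /gL gu; rewrite gu ltxx in guL.
Qed.

Lemma ramp_surj a c L g : ramp a c L g -> a < c ->
  forall y, 0 <= y <= L -> exists2 u, a <= u <= c & g u = y.
Proof.
move=> gP ac y yL; have L0 := ramp_gt0 gP ac; case: gP => _ g0 gL _ g_cont.
have [|||u uac guy] := @IVT R g a c y.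
- exact: ltW.
- exact: continuous_subspaceT.
- by rewrite g0 // gL // (min_l (ltW L0)) (max_r (ltW L0)).
by exists u => //; move: uac; rewrite in_itv.
Qed.

(** Precomposing with the clamp to [[0, L]] makes the inverse total and monotone, so that
    surjectivity onto [[a, c]] already yields continuity. *)
Lemma ramp_inv a c L g : ramp a c L g -> a < c ->
  exists h, [/\ continuous h, forall u, a <= u <= c -> h (g u) = u,
                forall y, a <= h y <= c & forall y, 0 <= y <= L -> g (h y) = y].
Proof.
move=> gP ac; have L0 := ramp_gt0 gP ac.
pose cl := clamp 0 L.
have clP y : 0 <= cl y <= L by apply: clamp_range; exact: ltW.
have cl_id y : 0 <= y <= L -> cl y = y by exact: clamp_id.
have cl_homo : {homo cl : x y / x <= y} by apply: clamp_homo; exact: ltW.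
have hex y : exists u, a <= u <= c /\ g u = cl y.
  by have [u uac guy] := ramp_surj gP ac (clP y); exists u.
have [h hP] := choice hex.
have hK u : a <= u <= c -> h (g u) = u.
  move=> uac; have [h1 h2] := hP (g u); apply: (ramp_inj gP) => //.
  by rewrite h2 cl_id // (ramp_range gP) // ltW.
exists h; split=> //.
- apply: (@mono_surj_continuous a c).
  + move=> x y xy; rewrite leNgt; apply/negP => hyx.
    have [hx1 hx2] := hP x; have [hy1 hy2] := hP y.
    case: gP => _ _ _ g_incr _.
    have := g_incr _ _ _ hyx; rewrite hx2 hy2 => H.
    have : cl y < cl x by apply: H; lra.
    by rewrite ltNge cl_homo.
  + by move=> x; case: (hP x).
  + by move=> y yac; exists (g y); exact: hK.
- by move=> y; case: (hP y).
- by move=> y yL; case: (hP y) => _ ->; exact: cl_id.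
Qed.

Lemma ramp_comp a c g a1 c1 L g1 h : ramp a c 1 g -> a < c ->
  (forall y, a <= h y <= c) -> (forall y, 0 <= y <= 1 -> g (h y) = y) ->
  0 <= a1 -> a1 < c1 -> c1 <= 1 -> ramp a1 c1 L g1 ->
  ramp (h a1) (h c1) L (g1 \o g).
Proof.
move=> gP ac hac hK a10 ac1 c11 [g1_homo g10 g1L g1_incr g1_cont].
have ga1 : g (h a1) = a1 by apply: hK; lra.
have gc1 : g (h c1) = c1 by apply: hK; lra.
have [ha1 ha2] := andP (hac a1); have [hc1 hc2] := andP (hac c1).
case: (gP) => g_homo g0 gL g_incr g_cont; split=> /=.
- by move=> x y xy; apply/g1_homo/g_homo.
- by move=> u ua; apply: g10; rewrite -ga1; exact: g_homo.
- by move=> u ua; apply: g1L; rewrite -gc1; exact: g_homo.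
- move=> u w au uw wc; apply: g1_incr.
  + by rewrite -ga1; exact: g_homo.
  + by apply: g_incr => //; lra.
  + by rewrite -gc1; exact: g_homo.
- by move=> u; apply: continuous_comp; [exact: g_cont|exact: g1_cont].
Qed.

Lemma ramp_rev a c L g : ramp a c L g ->
  ramp (1 - c) (1 - a) L (fun u => L - g (1 - u)).
Proof.
case=> g_homo g0 gL g_incr g_cont; split=> /=.
- by move=> x y xy; rewrite lerB // g_homo // lerB.
- by move=> u uc; rewrite gL ?subrr //; lra.
- by move=> u uc; rewrite g0 ?subr0 //; lra.
- move=> u w u1 uw wc; have : g (1 - w) < g (1 - u) by apply: g_incr; lra.
  lra.
- move=> u; apply: cvgB; first exact: cvg_cst.
  apply: continuous_comp; last exact: g_cont.
  by apply: cvgB; [exact: cvg_cst|exact: cvg_id].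
Qed.

Lemma ramp_clamp : ramp 0 1 1 (clamp 0 1).
Proof.
have l01 : (0 : R) <= 1 by exact: ler01.
split.
- exact: clamp_homo.
- by move=> u; exact: clamp_lo.
- by move=> u; exact: clamp_hi.
- by move=> u w u0 uw w1; rewrite !clamp_id //; lra.
- exact: clamp_continuous.
Qed.

Lemma ramp_extend a c L s : a < c -> 0 < L ->
  (forall u w, a < u -> u < w -> w < c -> s u < s w) ->
  (forall u, a < u < c -> 0 < s u < L) ->
  (forall y, 0 < y < L -> exists2 u, a < u < c & s u = y) ->
  exists g, ramp a c L g /\ forall u, a < u < c -> g u = s u.
Proof.
move=> ac L0 s_incr s_rng s_surj.
pose g u := if u <= a then 0 else if c <= u then L else s u.
have gs u : a < u < c -> g u = s u.
  by move=> /andP[au uc]; rewrite /g leNgt au /= leNgt uc.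
have ga u : u <= a -> g u = 0 by rewrite /g => ->.
have gc u : c <= u -> g u = L.
  by move=> cu; rewrite /g cu leNgt (lt_le_trans ac cu).
have g_incr u w : a <= u -> u < w -> w <= c -> g u < g w.
  rewrite le_eqVlt => /predU1P[<-|au] uw; rewrite le_eqVlt => /predU1P[wc|wc].
  - by rewrite wc ga // gc.
  - rewrite ga // gs; last by rewrite uw.
    by have /andP[] := s_rng w ltac:(by rewrite uw).
  - rewrite wc in uw *; rewrite (gc c) // gs; last by rewrite au.
    by have /andP[] := s_rng u ltac:(by rewrite au).
  - by rewrite !gs ?s_incr //; lra.
have g_rng u : 0 <= g u <= L.
  have [/ga ->|au] := leP u a; first by rewrite lexx ltW.
  have [/gc ->|uc] := leP c u; first by rewrite lexx ltW.
  rewrite gs ?au //; have := s_rng u ltac:(by rewrite au); lra.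
have g_homo : {homo g : x y / x <= y}.
  move=> x y; rewrite le_eqVlt => /predU1P[->//|xy].
  have [/ga ->|ax] := leP x a; first by have /andP[] := g_rng y.
  have [/gc ->|yc] := leP c y; first by have /andP[] := g_rng x.
  by apply/ltW/g_incr => //; exact: ltW.
exists g; split=> //; split=> //.
apply: (@mono_surj_continuous 0 L) => // y /andP[].
rewrite le_eqVlt => /predU1P[<- _|y0]; first by exists a; exact: ga.
rewrite le_eqVlt => /predU1P[->|yL]; first by exists c; exact: gc.
by have [|u uac <-] := s_surj y; [rewrite y0|exists u; exact: gs].
Qed.

(** One-sided limits are unique in a Hausdorff space. This is how identities known on open cells
    reach the vertices. *)
Lemma continuous_eq_segment (X : topologicalType) (p q : R -> X) a c :
  hausdorff_space X -> continuous p -> continuous q -> a < c ->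
  (forall u, a < u < c -> p u = q u) -> forall u, a <= u <= c -> p u = q u.
Proof.
move=> hX cp cq ac pq u /andP[].
rewrite le_eqVlt => /predU1P[<- _|au].
  apply: (@cvg_unique X hX (p @ a^'+)).
    exact/cvg_at_right_filter/cp.
  suff : q @ a^'+ --> q a.
    apply: cvg_trans; apply: near_eq_cvg.
    near=> z; symmetry; apply: pq; apply/andP; split; near: z.
      exact: nbhs_right_gt.
    exact: nbhs_right_lt.
  exact/cvg_at_right_filter/cq.
rewrite le_eqVlt => /predU1P[->|uc]; last by apply: pq; rewrite au.
apply: (@cvg_unique X hX (p @ c^'-)).
  exact/cvg_at_left_filter/cp.
suff : q @ c^'- --> q c.
  apply: cvg_trans; apply: near_eq_cvg.
  near=> z; symmetry; apply: pq; apply/andP; split; near: z.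
    exact: nbhs_left_gt.
  exact: nbhs_left_lt.
exact/cvg_at_left_filter/cq.
Unshelve. all: by end_near. Qed.

Lemma within_clamp_continuous (X : topologicalType) (p : R -> X) a b :
  a <= b -> {within `[a, b], continuous p} -> continuous (p \o clamp a b).
Proof.
move=> ab cp u.
have clab z : `[a, b]%classic (clamp a b z) by rewrite /= in_itv /= clamp_range.
have cpu : p @ within `[a, b] (nbhs (clamp a b u)) --> p (clamp a b u).
  by move/subspace_continuousP : cp; exact.
apply: (@cvg_comp _ _ _ (clamp a b) p (nbhs u)
  (within `[a, b] (nbhs (clamp a b u)))) => //.
move=> A; rewrite /within /= => nA.
have : \near u, `[a, b]%classic (clamp a b u) -> A (clamp a b u) := clamp_continuous ab nA.
by apply: filterS => z Az; exact/Az/clab.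
Qed.

End Ramps.

(** * The contraction *)


Section FunctionalEquation.
(** The fixed point argument needs no graph: [F e] stands for the edge-path of [e], [t e] for its
    subdivision points, [g e i] for the map on the [i]-th subinterval read in the parameter of its
    target edge, and [ell] for the lengths, [ell_sum] being the eigenvector equation. *)
Variables (R : realType) (E : eqType) (F : E -> seq E).
Variables (t : E -> nat -> R) (g : E -> nat -> R -> R) (ell : E -> R).
Variables (lam M : R).
Hypothesis lam_gt1 : 1 < lam.
Hypothesis t0 : forall e, t e 0 = 0.
Hypothesis t1 : forall e, t e (size (F e)) = 1.
Hypothesis t_lt : forall e i, (i < size (F e))%N -> t e i < t e i.+1.
Hypothesis gP : forall e i, (i < size (F e))%N -> ramp (t e i) (t e i.+1) 1 (g e i).
Hypothesis ell_gt0 : forall e, 0 < ell e.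
Hypothesis ell_le : forall e, ell e <= M.
Hypothesis ell_sum : forall e, \sum_(x <- F e) ell x = lam * ell e.

Implicit Types (Phi Psi : E -> R -> R) (e : E) (u : R).

Local Notation q := (lam^-1).

(* The subintervals before [u] contribute their whole length and those after [u]
   contribute 0, since [g e i] is constant off the [i]-th subinterval. *)
Definition pullback Phi e u : R :=
  q * \sum_(i < size (F e)) Phi (nth e (F e) i) (g e i u).

(** With both end values prescribed, every summand of [pullback] other than that of the subinterval
    containing [u] is the same for all [Phi]. *)
Definition normalized Phi := forall e,
  (forall u, u <= 0 -> Phi e u = 0) /\ (forall u, 1 <= u -> Phi e u = ell e).

Let lam_gt0 : 0 < lam. Proof. exact: lt_trans lam_gt1. Qed.
Let q_gt0 : 0 < q. Proof. by rewrite invr_gt0. Qed.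
Let M_ge0 e : 0 <= M. Proof. exact: le_trans (ltW (ell_gt0 e)) (ell_le e). Qed.

Lemma geometric_le0 (x C : R) : (forall k, x <= q ^+ k * C) -> x <= 0.
Proof.
move=> xC; have qk : (fun k => q ^+ k * C) @ \oo --> (0 : R).
  rewrite -(mul0r C); apply: cvgMl; apply: cvg_expr.
  by rewrite gtr0_norm // invf_lt1.
rewrite leNgt; apply/negP => x0.
have := cvgr_lt 0 qk x x0 => -[k _ /(_ k (leqnn k))] /=.
by rewrite ltNge xC.
Qed.

Lemma subdivision_le e i j :
  (i <= j)%N -> (j <= size (F e))%N -> t e i <= t e j.
Proof.
elim: j => [|j IH]; first by rewrite leqn0 => /eqP ->.
rewrite leq_eqVlt => /predU1P[->//|ij] jn.
by apply: (le_trans (IH ij (ltnW jn))); exact/ltW/t_lt.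
Qed.

Lemma subdivision_locate e u : 0 <= u <= 1 ->
  exists2 i, (i < size (F e))%N & t e i <= u <= t e i.+1.
Proof.
move=> /andP[u0 u1].
have : forall n, (n <= size (F e))%N -> (0 < n)%N -> u <= t e n ->
    exists2 i, (i < size (F e))%N & t e i <= u <= t e i.+1.
  elim=> [//|n IH] nF _ un.
  have [tu|ut] := leP (t e n) u; first by exists n => //; rewrite tu.
  case: n => [|n] in IH nF un ut *; first by rewrite t0 ltNge u0 in ut.
  by apply: IH => //; [exact: ltnW|exact: ltW].
apply; [exact: leqnn| |by rewrite t1].
by case En : (size (F e)) (t0 e) (t1 e) => [|//] -> /esym /eqP; rewrite oner_eq0.
Qed.

Lemma pullbackE Phi e i u : normalized Phi -> (i < size (F e))%N ->
  t e i <= u <= t e i.+1 ->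
  pullback Phi e u = q * (\sum_(j < i) ell (nth e (F e) j))
     + q * Phi (nth e (F e) i) (g e i u).
Proof.
move=> Phi_flat iF /andP[tu ut]; rewrite /pullback -mulrDr; congr (_ * _).
rewrite -(big_mkord xpredT (fun j => Phi (nth e (F e) j) (g e j u))) /=.
rewrite (big_cat_nat (n := i)) //=; last exact: ltnW.
congr (_ + _).
  rewrite big_mkord; apply: eq_bigr => j _.
  have jF : (j < size (F e))%N := ltn_trans (ltn_ord j) iF.
  have [_ _ -> //] := gP jF; first by case: (Phi_flat (nth e (F e) j)) => _ ->.
  by apply: le_trans tu; apply: subdivision_le => //; exact: ltnW.
rewrite big_ltn // big_nat big1 ?addr0 // => j /andP[ij jF].
have [_ -> //] := gP jF; first by case: (Phi_flat (nth e (F e) j)) => ->.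
by apply: le_trans ut _; apply: subdivision_le => //; exact: ltnW.
Qed.

Lemma pullback_local Phi e i u : normalized Phi -> (i < size (F e))%N ->
  t e i <= u <= t e i.+1 ->
  pullback Phi e u = pullback Phi e (t e i) + q * Phi (nth e (F e) i) (g e i u).
Proof.
move=> Phi_flat iF tu; rewrite !(pullbackE Phi_flat iF) //; last first.
  by rewrite lexx ltW // t_lt.
have [_ g0 _ _ _] := gP iF; rewrite (g0 _ (lexx (t e i))).
have [Phi0 _] := Phi_flat (nth e (F e) i).
by rewrite (Phi0 _ (lexx 0)) mulr0 addr0.
Qed.

Lemma pullback_normalized Phi : normalized Phi -> normalized (pullback Phi).
Proof.
move=> Phi_flat e; split=> u u0.
  rewrite /pullback big1 ?mulr0 // => i _.
  have [_ -> //] := gP (ltn_ord i); first by case: (Phi_flat (nth e (F e) i)) => ->.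
  by rewrite (le_trans u0) // -(t0 e); apply: subdivision_le => //; exact: ltnW.
rewrite /pullback (eq_bigr (fun i : 'I__ => ell (nth e (F e) i))) => [|i _].
  have := ell_sum e; rewrite (big_nth e) big_mkord => ->.
  by rewrite mulKf // gt_eqF.
have [_ _ -> //] := gP (ltn_ord i); first by case: (Phi_flat (nth e (F e) i)) => _ ->.
by rewrite (le_trans _ u0) // -(t1 e); apply: subdivision_le.
Qed.

(** At a given [u] the two sums differ in a single summand, so the factor is [q] and not [q] times
    the number of edges of [F e]. *)
Lemma pullback_contraction Phi Psi (m : R) : normalized Phi -> normalized Psi ->
  (forall e u, `|Phi e u - Psi e u| <= m) ->
  forall e u, `|pullback Phi e u - pullback Psi e u| <= q * m.
Proof.
move=> Phi_flat Psi_flat le_m e u.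
have m0 : 0 <= m by apply: le_trans (le_m e 0).
have qm0 : 0 <= q * m by rewrite mulr_ge0 // ltW.
have [Phi0 Phi1] := pullback_normalized Phi_flat e.
have [Psi0 Psi1] := pullback_normalized Psi_flat e.
have [u0|/ltW u0] := leP u 0; first by rewrite Phi0 // Psi0 // subrr normr0.
have [u1|/ltW u1] := leP 1 u; first by rewrite Phi1 // Psi1 // subrr normr0.
have [|i iF tu] := @subdivision_locate e u; first by rewrite u0.
rewrite !(pullbackE _ iF) // opprD addrACA subrr add0r -mulrBr normrM.
by rewrite gtr0_norm // ler_pM2l.
Qed.

Lemma normalized_fixpoint_unique Phi Psi : normalized Phi -> normalized Psi ->
  (forall e u, 0 <= Phi e u <= ell e) -> (forall e u, 0 <= Psi e u <= ell e) ->
  (forall e u, Phi e u = pullback Phi e u) ->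
  (forall e u, Psi e u = pullback Psi e u) ->
  forall e u, Phi e u = Psi e u.
Proof.
move=> Phi_flat Psi_flat Phi_rng Psi_rng PhiE PsiE e u.
have H k : forall e u, `|Phi e u - Psi e u| <= q ^+ k * M.
  elim: k => [|k IH] e1 u1.
    rewrite mul1r; have := Phi_rng e1 u1; have := Psi_rng e1 u1.
    by have := ell_le e1; rewrite ler_norml; lra.
  by rewrite PhiE PsiE exprS -mulrA; exact: pullback_contraction.
apply/eqP; rewrite -subr_eq0 -normr_le0; apply: (@geometric_le0 _ M) => k.
exact: H.
Qed.

(** The local equation controls only increments; the values at the division points follow by
    induction from the common value 0 at [t e 0]. *)
Lemma normalized_fixpoint_of_local Phi : normalized Phi ->
  (forall e i u, (i < size (F e))%N -> t e i <= u <= t e i.+1 ->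
     Phi e u = Phi e (t e i) + q * Phi (nth e (F e) i) (g e i u)) ->
  forall e u, Phi e u = pullback Phi e u.
Proof.
move=> Phi_flat loc e u.
have [Phi0 Phi1] := Phi_flat e.
have [pPhi0 pPhi1] := pullback_normalized Phi_flat e.
have tE i : (i <= size (F e))%N -> Phi e (t e i) = pullback Phi e (t e i).
  elim: i => [|i IH] iF; first by rewrite t0 Phi0 // pPhi0.
  have tii : t e i <= t e i.+1 <= t e i.+1 by rewrite lexx ltW // t_lt.
  rewrite (loc _ _ _ iF tii) (pullback_local Phi_flat iF tii).
  by rewrite IH // ltnW.
have [u0|/ltW u0] := leP u 0; first by rewrite Phi0 // pPhi0.
have [u1|/ltW u1] := leP 1 u; first by rewrite Phi1 // pPhi1.
have [|i iF tu] := @subdivision_locate e u; first by rewrite u0.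
by rewrite (loc _ _ _ iF tu) (pullback_local Phi_flat iF tu) tE // ltnW.
Qed.

Lemma fixpoint_exists : exists D : E -> R -> R, [/\ normalized D,
  forall e, {homo D e : x y / x <= y}, forall e, continuous (D e) &
  forall e u, D e u = pullback D e u].
Proof.
(* The start is the coordinate proportional to the parameter. Monotonicity and continuity are
   preserved by [pullback] and pass to the uniform limit. *)
pose P k := iter k pullback (fun e u => ell e * clamp 0 1 u).
have P_flat k : normalized (P k).
  elim: k => [|k IH]; last exact: pullback_normalized.
  move=> e; split=> u u0; first by rewrite /P /= clamp_lo ?mulr0.
  by rewrite /P /= clamp_hi ?mulr1.
have P_homo k : forall e, {homo P k e : x y / x <= y}.
  elim: k => [|k IH] e x y xy; first by rewrite /P /= ler_pM2l // clamp_homo.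
  rewrite /P /= ler_pM2l //; apply: ler_sum => i _; apply: IH.
  by have [+ _ _ _ _] := gP (ltn_ord i); exact.
have P_cont k : forall e, continuous (P k e).
  elim: k => [|k IH] e u.
    by apply: cvgM; [exact: cvg_cst|exact: clamp_continuous].
  apply: cvgM; first exact: cvg_cst.
  apply: cvg_big; [exact: add_continuous|move=> i _].
  apply: continuous_comp; last exact: IH.
  by have [_ _ _ _] := gP (ltn_ord i); exact.
have P_rng k e u : 0 <= P k e u <= ell e.
  have [P0 P1] := P_flat k e; rewrite -{1}(P0 (Num.min u 0)) ?ge_min ?lexx ?orbT //.
  rewrite P_homo ?ge_min ?lexx //=.
  by rewrite -(P1 (Num.max u 1)) ?le_max ?lexx ?orbT // P_homo ?le_max ?lexx.
have P_near k m e u : `|P (k + m)%N e u - P k e u| <= q ^+ k * M.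
  elim: k e u => [|k IH] e u.
    rewrite mul1r add0n; have := P_rng m e u; have := P_rng 0%N e u.
    by have := ell_le e; rewrite ler_norml; lra.
  by rewrite exprS -mulrA; exact: pullback_contraction.
(* As [P j] stays within [q ^+ k * M] of [P k] for [k <= j], the supremum of
   [S e u] is the limit of [P k e u]. *)
pose S e u := [set P k e u - q ^+ k * M | k in [set: nat]].
pose D e u := sup (S e u).
have S_ub k e u : ubound (S e u) (P k e u + q ^+ k * M).
  move=> _ [j _ <-].
  have qkM i : 0 <= q ^+ i * M.
    by rewrite mulr_ge0 ?exprn_ge0 ?(ltW q_gt0) // (M_ge0 e).
  have [kj|jk] := leqP k j.
    have := P_near k (j - k)%N e u; rewrite subnKC // ler_norml.
    by have := qkM j; lra.
  have := P_near j (k - j)%N e u; rewrite subnKC ?(ltnW jk) // ler_norml.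
  by have := qkM k; lra.
have D_near k e u : `|D e u - P k e u| <= q ^+ k * M.
  have S_sup : has_sup (S e u).
    split; first by exists (P 0%N e u - q ^+ 0 * M); exists 0%N.
    by exists (P 0%N e u + q ^+ 0 * M); exact: S_ub.
  have ub : D e u <= P k e u + q ^+ k * M.
    by apply: ge_sup; [case: S_sup|exact: S_ub].
  have lb : P k e u - q ^+ k * M <= D e u by apply: sup_upper_bound => //; exists k.
  by rewrite ler_norml; lra.
have D_flat : normalized D.
  move=> e; split=> u u0; apply/eqP; rewrite -subr_eq0 -normr_le0;
    apply: (@geometric_le0 _ M) => k.
    by have := D_near k e u; have [-> // _] := P_flat k e.
  by have := D_near k e u; have [_ ->] := P_flat k e.
exists D; split=> //.
- move=> e x y xy; rewrite -subr_le0; apply: (@geometric_le0 _ (2 * M)) => k.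
  have := D_near k e x; have := D_near k e y; have := P_homo k e _ _ xy.
  by rewrite !ler_norml; lra.
- move=> e u; apply/cvgrPdist_le => /= r r0.
  (* Two errors of [q ^+ k * M], at [u] and at [w], and [r / 3] from the continuity of [P k] add up
     to at most [r]. *)
  have [k kr] : exists k, q ^+ k * (3 * M) <= r.
    apply: contrapT => /forallNP H.
    have : r <= 0.
      apply: (@geometric_le0 _ (3 * M)) => k.
      by apply/ltW; rewrite ltNge; exact/negP.
    by rewrite leNgt r0.
  have r3 : 0 < r / 3 by lra.
  have /cvgrPdist_le /(_ _ r3) := P_cont k e u; apply: filterS => w /= Pw.
  have := D_near k e u; have := D_near k e w; move: Pw.
  by rewrite !ler_norml; lra.
- move=> e u; apply/eqP; rewrite -subr_eq0 -normr_le0.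
  apply: (@geometric_le0 _ (2 * M)) => k.
  have qq : 0 <= q ^+ k * M by rewrite mulr_ge0 ?exprn_ge0 ?(ltW q_gt0) // (M_ge0 e).
  have q1 : q * (q ^+ k * M) <= q ^+ k * M.
    by rewrite ler_piMl // invf_le1 // ltW.
  have -> : D e u - pullback D e u =
      (D e u - P k.+1 e u) - (pullback D e u - P k.+1 e u) by ring.
  have -> : q ^+ k * (2 * M) = q ^+ k * M + q ^+ k * M by ring.
  apply: le_trans (ler_normB _ _) _; apply: lerD; apply: le_trans q1.
    by have := D_near k.+1 e u; rewrite exprS -mulrA.
  exact: pullback_contraction.
Qed.

End FunctionalEquation.

(** * The Perron-Frobenius theorem *)


Section PerronFrobeniusTheorem.
Variables (R : realType) (n : nat) (A : 'M[R]_n).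
Hypothesis A_ge0 : forall i j, 0 <= A i j.
Hypothesis A_irr : irreducible_mx A.

Let expA_ge0 k i j : 0 <= (A ^+ k) i j.
Proof.
elim: k i j => [|k IH] i j; first by rewrite expr0 mxE ler0n.
by rewrite exprS -mulmxE mxE; apply: sumr_ge0 => l _; rewrite mulr_ge0.
Qed.

(** A single power of an irreducible matrix may have zero entries because of periodicity, hence the
    sum of powers; one range of exponents serves all entries. *)
Lemma irreducible_sum_gt0 : exists N, forall i j,
  0 < (\sum_(s < N) A ^+ s) i j.
Proof.
have [t tP] : exists t : 'I_n * 'I_n -> nat, forall p, 0 < (A ^+ t p) p.1 p.2.
  have H (p : 'I_n * 'I_n) : exists t, 0 < (A ^+ t) p.1 p.2.
    by have [t [_ tp]] := A_irr p.1 p.2; exists t.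
  by have [t tP] := choice H; exists t.
exists (\max_p t p).+1 => i j; rewrite summxE.
have tN : (t (i, j) < (\max_p t p).+1)%N by rewrite ltnS leq_bigmax.
rewrite (bigD1 (Ordinal tN)) //=.
by apply: ltr_pwDl; [exact: (tP (i, j))|exact: sumr_ge0].
Qed.

(** [B] is a polynomial in [A], so it commutes with [A] and keeps its eigenvectors; being positive,
    it turns weak inequalities between distinct vectors into strict ones. *)
Lemma irreducible_positivity : exists B : 'M[R]_n,
  [/\ B *m A = A *m B,
      forall x : 'cV[R]_n, (forall i, 0 <= x i 0) -> x != 0 ->
        forall i, 0 < (B *m x) i 0 &
      forall r (y : 'cV[R]_n), A *m y = r *: y -> exists s, B *m y = s *: y].
Proof.
have [N NP] := irreducible_sum_gt0.
exists (\sum_(s < N) A ^+ s); split.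
- rewrite mulmx_suml mulmx_sumr; apply: eq_bigr => s _.
  by rewrite !mulmxE -exprS -exprSr.
- move=> x x_ge0 x_neq0 i; rewrite mxE.
  have [j xj] : exists j, x j 0 != 0.
    apply: contrapT => /forallNP H; move/eqP : x_neq0; apply.
    by apply/matrixP => k l; rewrite ord1 mxE; apply/eqP; move: (H k); case: eqP.
  rewrite (bigD1 j) //=; apply: ltr_pwDl.
    by rewrite mulr_gt0 // lt_neqAle eq_sym xj x_ge0.
  by apply: sumr_ge0 => k _; rewrite mulr_ge0 // ltW.
- move=> r y Ay; exists (\sum_(s < N) r ^+ s).
  rewrite mulmx_suml scaler_suml; apply: eq_bigr => s _.
  elim: (val s) => [|k IH]; first by rewrite !expr0 mul1mx scale1r.
  by rewrite exprSr -mulmxE -mulmxA Ay -scalemxAr IH scalerA -exprS.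
Qed.

Lemma positive_minimum (I : finType) (F : I -> R) : (forall i, 0 < F i) ->
  exists2 m, 0 < m & forall i, m <= F i.
Proof.
move=> F_gt0; exists (\big[Num.min/1]_i F i); last by move=> i; exact: bigmin_le.
by apply/bigmin_gtP; split=> // i _.
Qed.

(** Subtracting from [w] the largest multiple of [v] that keeps it non-negative leaves a vector with
    a zero entry. [B] multiplies it by a scalar, yet would make that entry positive unless the
    vector is zero; the normalization then fixes the multiple. *)
Lemma PF_eigenvector_unique (r : R) (v w : 'cV[R]_n) :
  (forall i, 0 < v i 0) -> A *m v = r *: v -> \sum_i v i 0 = 1 ->
  (forall i, 0 < w i 0) -> A *m w = r *: w -> \sum_i w i 0 = 1 -> w = v.
Proof.
move=> v_gt0 Av v1 w_gt0 Aw w1.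
have [i0] : inhabited 'I_n.
  case: n v {w v_gt0 Av w_gt0 Aw w1} v1 => [v|m _ _]; last by split; exact: ord0.
  by rewrite big_ord0 => /eqP; rewrite eq_sym oner_eq0.
have [i _ i_min] := @Order.TotalTheory.arg_minP _ _ _ i0 xpredT (fun i => w i 0 / v i 0) isT.
pose s := w i 0 / v i 0; pose u := w - s *: v.
have u_ge0 j : 0 <= u j 0.
  by have := i_min j isT; rewrite ler_pdivlMr // !mxE subr_ge0.
have ui : u i 0 = 0 by rewrite !mxE divfK ?subrr // gt_eqF.
have Au : A *m u = r *: u.
  by rewrite mulmxBr -scalemxAr Av Aw scalerBr !scalerA mulrC.
have u0 : u = 0.
  apply/eqP/negPn/negP => u_neq0.
  have [B [_ Bpos Beig]] := irreducible_positivity.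
  have [s' Bs'] := Beig r u Au.
  by have := Bpos u u_ge0 u_neq0 i; rewrite Bs' mxE ui mulr0 ltxx.
have wE : w = s *: v by apply/eqP; rewrite -subr_eq0; exact/eqP.
have : \sum_i w i 0 = s * \sum_i v i 0.
  by rewrite wE mulr_sumr; apply: eq_bigr => j _; rewrite mxE.
by rewrite w1 v1 mulr1 => s1; rewrite wE -s1 scale1r.
Qed.

Lemma PF_eigenvector_exists : (0 < n)%N -> exists r (v : 'cV[R]_n),
  [/\ 0 <= r, forall i, 0 < v i 0, A *m v = r *: v & \sum_i v i 0 = 1].
Proof.
move=> n0; pose i0 := Ordinal n0.
pose M := \sum_i \sum_j A i j.
(* Pairs of a number [r] and a point [x] of the simplex with [r x <= A x] entrywise. Summing these
   inequalities shows that bounding [r] by [M], the sum of all entries, loses nothing. *)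
pose K := (`[0, M]%classic `*` [set x : 'rV[R]_n | forall i, `[0, 1]%classic (x ord0 i)])
  `&` ([set p : R * 'rV[R]_n | \sum_i p.2 0 i = 1]
  `&` \bigcap_(i in [set: 'I_n])
     [set p : R * 'rV[R]_n | 0 <= \sum_j A i j * p.2 0 j - p.1 * p.2 0 i]).
have coord_cont i : continuous (fun p : R * 'rV[R]_n => p.2 0 i).
  move=> p; apply: (@continuous_comp _ _ _ snd (fun x : 'rV[R]_n => x 0 i)).
    exact: cvg_snd.
  exact: coord_continuous.
have K_compact : compact K.
  apply: compact_closedI.
    apply: compact_setX; first exact: segment_compact.
    by apply: (@rV_compact R n (fun=> `[0, 1]%classic)) => i; exact: segment_compact.
  apply: closedI.
    apply: (@closed_comp _ _ (fun p : R * 'rV[R]_n => \sum_i p.2 0 i) [set 1]).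
      move=> p _; apply: cvg_big; first exact: add_continuous.
      by move=> i _; exact: coord_cont.
    exact: closed_eq.
  apply: closed_bigI => i _.
  apply: (@closed_comp _ _ (fun p : R * 'rV[R]_n =>
    \sum_j A i j * p.2 0 j - p.1 * p.2 0 i) [set x | 0 <= x]); last exact: closed_ge.
  move=> p _; apply: cvgB; last by apply: cvgM; [exact: cvg_fst|exact: coord_cont].
  apply: cvg_big; first exact: add_continuous.
  by move=> j _; apply: cvgM; [exact: cvg_cst|exact: coord_cont].
(* [r] is the Collatz-Wielandt maximum: if [A *m v] were different from [r *: v],
   applying the positive matrix [B] below would make all inequalities strict, and
   [r] could be increased. *)
pose feas r (v : 'cV[R]_n) := [/\ 0 <= r, forall i, 0 <= v i 0, \sum_i v i 0 = 1 &
  forall i, r * v i 0 <= (A *m v) i 0].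
have v_le1 (v : 'cV[R]_n) : (forall i, 0 <= v i 0) -> \sum_i v i 0 = 1 -> forall i, v i 0 <= 1.
  move=> v_ge0 <- i; rewrite (bigD1 i) //= lerDl; exact: sumr_ge0.
have feasK r v : feas r v -> K (r, v^T).
  case=> r0 v_ge0 v1 rv; split; [split|split] => /=.
  - rewrite in_itv /= r0 /= -[r]mulr1 -v1 mulr_sumr; apply: ler_sum => i _.
    apply: (le_trans (rv i)); rewrite mxE; apply: ler_sum => j _.
    by rewrite ler_piMr // v_le1.
  - by move=> i; rewrite mxE in_itv /= v_ge0 v_le1.
  - by rewrite -v1; apply: eq_bigr => i _; rewrite mxE.
  - move=> i _ /=; rewrite subr_ge0 mxE; apply: (le_trans (rv i)).
    by rewrite mxE; apply: ler_sum => j _; rewrite mxE.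
have Kfeas r x : K (r, x) -> feas r x^T.
  case=> -[/=]; rewrite in_itv /= => /andP[r0 _] x01 [/= x1 rx]; split => //.
  - by move=> i; rewrite mxE; have := x01 i; rewrite in_itv /= => /andP[].
  - by rewrite -x1; apply: eq_bigr => i _; rewrite mxE.
  - move=> i; have := rx i I; rewrite /= subr_ge0 mxE => /le_trans; apply.
    by rewrite mxE; apply: ler_sum => j _; rewrite mxE.
have K0 : K !=set0.
  exists (0, (delta_mx i0 0 : 'cV[R]_n)^T); apply: feasK; split => //.
  - by move=> i; rewrite mxE ler0n.
  - rewrite (bigD1 i0) //= mxE !eqxx big1 ?addr0 // => j ji.
    by rewrite mxE (negbTE ji).
  - move=> i; rewrite mul0r mxE; apply: sumr_ge0 => j _.
    by rewrite mulr_ge0 // mxE ler0n.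
have [[r x] /set_mem Krx r_max] := @compact_EVT_max _ R fst K K0 K_compact
  (@continuous_subspaceT _ _ K fst (fun p => @cvg_fst _ _ _ _ _)).
have [r0 v_ge0 v1 rv] := Kfeas _ _ Krx.
set v := x^T in v_ge0 v1 rv.
have v_neq0 : v != 0.
  apply/eqP => v0; move: v1; rewrite v0 big1 => [/eqP|i _]; last by rewrite mxE.
  by rewrite eq_sym oner_eq0.
have [B [BA Bpos Beig]] := irreducible_positivity.
have Bv_gt0 := Bpos v v_ge0 v_neq0.
have residualE (u : 'cV[R]_n) s i :
    (A *m u - s *: u) i 0 = (A *m u) i 0 - s * u i 0 by rewrite !mxE.
have Av : A *m v = r *: v.
  apply/eqP; rewrite -subr_eq0; apply/negPn/negP => z_neq0.
  have z_ge0 i : 0 <= (A *m v - r *: v) i 0.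
    by rewrite residualE subr_ge0.
  have Bz_gt0 := Bpos _ z_ge0 z_neq0.
  pose y := B *m v; pose s := \sum_i y i 0.
  have s_gt0 : 0 < s.
    rewrite /s (bigD1 i0) //=; apply: ltr_pwDl; first exact: Bv_gt0.
    by apply: sumr_ge0 => i _; exact/ltW/Bv_gt0.
  (* The gain [m] is a lower bound for the ratios between the entries of [B] applied to the residual
     and those of [y]; thus [y], rescaled to sum 1, admits [r + m]. *)
  have [m m_gt0 mP] : exists2 m, 0 < m & forall i,
      m <= (B *m (A *m v - r *: v)) i 0 / y i 0.
    by apply: positive_minimum => i; rewrite divr_gt0.
  have : feas (r + m) (s^-1 *: y).
    split.
    - by rewrite addr_ge0 // ltW.
    - by move=> i; rewrite mxE mulr_ge0 ?invr_ge0 ?(ltW s_gt0) // ltW // Bv_gt0.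
    - under eq_bigr do rewrite mxE.
      by rewrite -mulr_sumr mulVf // gt_eqF.
    - move=> i; rewrite -scalemxAr [leRHS]mxE [X in _ * X]mxE mulrCA.
      rewrite ler_pM2l ?invr_gt0 //.
      have := mP i; rewrite ler_pdivlMr; last exact: Bv_gt0.
      rewrite mulmxBr mulmxA BA -scalemxAr -mulmxA -/y => H.
      rewrite mulrDl -lerBrDl; apply: (le_trans H).
      by rewrite residualE.
  move/feasK/mem_set/r_max; rewrite /= gerDl leNgt; exact/negP/negPn.
exists r, v; split=> // i.
have [s Bs] := Beig r v Av.
rewrite lt_neqAle v_ge0 andbT eq_sym; apply/eqP => vi0.
by have := Bv_gt0 i; rewrite Bs mxE vi0 mulr0 ltxx.
Qed.

End PerronFrobeniusTheorem.

(** If [x] is a complex left eigenvector for [z], its moduli [y] satisfy [|z| y <= y A]; pairing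
    with the positive right eigenvector [v] gives [|z| <= r]. *)
Lemma spectral_radius_PF (R : realType) (n : nat) (A : 'M[R]_n) (r : R)
    (v : 'cV[R]_n) : (0 < n)%N -> (forall i j, 0 <= A i j) ->
  (forall i, 0 < v i 0) -> A *m v = r *: v -> spectral_radius A = r.
Proof.
move=> n0 A_ge0 v_gt0 Av; pose i0 := Ordinal n0.
have r0 : 0 <= r.
  rewrite -(pmulr_lge0 _ (v_gt0 i0)).
  have -> : r * v i0 0 = (A *m v) i0 0 by rewrite Av mxE.
  by rewrite mxE; apply: sumr_ge0 => j _; rewrite mulr_ge0 // ltW.
rewrite /spectral_radius; set S := [set _ | _ in _].
have S_ub : ubound S r.
  move=> _ [z /= /eigenvalueP[x xz x_neq0] <-].
  pose y i := Normc.normc (x 0 i).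
  have y_ge0 i : 0 <= y i by rewrite /y; case: (x 0 i) => a b; exact: sqrtr_ge0.
  have [j xj] : exists j, x 0 j != 0.
    apply: contrapT => /forallNP H; move/eqP : x_neq0; apply.
    by apply/matrixP => k l; rewrite ord1 mxE; apply/eqP; move: (H l); case: eqP.
  have yj : 0 < y j.
    rewrite lt_neqAle y_ge0 andbT eq_sym; apply/eqP => /Normc.eq0_normc.
    by move/eqP: xj.
  have yA k : Normc.normc z * y k <= \sum_i y i * A i k.
    rewrite /y -Normc.normcM.
    have -> : z * x 0 k = (z *: x) 0 k by rewrite mxE.
    rewrite -xz mxE.
    apply: (@big_ind2 _ _ (fun (a : R[i]) b => Normc.normc a <= b)).
    - by rewrite Normc.normc0.
    - move=> a1 b1 a2 b2 H1 H2; apply: le_trans (lerD H1 H2).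
      exact: le_normcD.
    - move=> i _; rewrite Normc.normcM !mxE ler_wpM2l //; first exact: y_ge0.
      by rewrite /= expr0n addr0 sqrtr_sqr ger0_norm.
  have yv_gt0 : 0 < \sum_k y k * v k 0.
    rewrite (bigD1 j) //=; apply: ltr_pwDl; first by rewrite mulr_gt0.
    by apply: sumr_ge0 => k _; rewrite mulr_ge0 // ltW.
  rewrite -(ler_pM2r yv_gt0) mulr_sumr.
  apply: (@le_trans _ _ (\sum_k (\sum_i y i * A i k) * v k 0)).
    by apply: ler_sum => k _; rewrite mulrA ler_pM2r.
  under eq_bigr do rewrite mulr_suml.
  rewrite exchange_big /= mulr_sumr; apply: ler_sum => i _.
  have -> : r * (y i * v i 0) = y i * (A *m v) i 0 by rewrite Av mxE mulrCA.
  by rewrite mxE mulr_sumr; apply: ler_sum => k _; rewrite mulrA.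
have Sr : S r.
  exists (real_complex R r) => /=; last first.
    by rewrite /= expr0n addr0 sqrtr_sqr ger0_norm.
  (* [eigenvalue] concerns row vectors whereas [v] is a column, so the passage goes through the
     singularity of [A - r%:M]. *)
  have : ~~ row_free (A - r%:M).
    rewrite row_free_unit; apply/negP => U.
    have : invmx (A - r%:M) *m ((A - r%:M) *m v) = 0.
      by rewrite mulmxBl Av mul_scalar_mx subrr mulmx0.
    rewrite mulKmx // => v0; have := v_gt0 i0; rewrite v0 mxE ltxx //.
  rewrite -(row_free_map (real_complex R)) map_mxB map_scalar_mx => H.
  by rewrite /eigenvalue /eigenspace kermx_eq0.
apply/eqP; rewrite eq_le; apply/andP; split.
  by apply: ge_sup => //; exists r.
by apply: ub_le_sup => //; exists r.
Qed.

(** * Cells and subdivisions *)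


Section Cells.
Variables (R : realType) (G : tgraph R).
Implicit Types (e : gedge G) (u w a c : R) (phi : R -> G).

Lemma cellP e x : cell e x <-> exists2 u, 0 < u < 1 & gchar e u = x.
Proof.
by split=> -[u u01 <-]; exists u => //; move: u01; rewrite /= in_itv.
Qed.

Lemma gchar_cell e u : 0 < u < 1 -> cell e (gchar e u).
Proof. by move=> u01; apply/cellP; exists u. Qed.

Lemma gchar_vert e u : u = 0 \/ u = 1 -> gvert (gchar e u).
Proof. by have [_ _ v0 v1] := gcharP e; case=> ->. Qed.

Lemma gchar_novert e u : 0 < u < 1 -> ~ gvert (gchar e u).
Proof. by move=> u01 /(@gvert_cell _ _ e); apply; exact: gchar_cell. Qed.

Lemma gchar_coord e : exists gam : G -> R,
  {within cell e, continuous gam} /\ forall u, 0 < u < 1 -> gam (gchar e u) = u.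
Proof.
have [_ [_ _ [gam [gam_cont gamK]]] _ _] := gcharP e.
by exists gam; split=> // u u01; apply: gamK; rewrite /= in_itv.
Qed.

Lemma gchar_inj e u w : 0 < u < 1 -> 0 < w < 1 -> gchar e u = gchar e w -> u = w.
Proof.
move=> u01 w01 uw; have [gam [_ gamK]] := gchar_coord e.
by rewrite -(gamK u) // uw gamK.
Qed.

(* [gchar e] is junk outside [0, 1]; clamping makes it continuous on R. *)
Definition echar e : R -> G := gchar e \o clamp 0 1.

Arguments echar : simpl never.

Lemma echarE e u : 0 <= u <= 1 -> echar e u = gchar e u.
Proof. by move=> u01; rewrite /echar /= clamp_id. Qed.

Lemma echar_continuous e : continuous (echar e).
Proof.
apply: within_clamp_continuous; first exact: ler01.
by have [] := gcharP e.
Qed.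

Lemma gchar_ginv e u : 0 <= u <= 1 -> gchar (ginv e) u = gchar e (1 - u).
Proof. exact: gchar_inv. Qed.

Lemma cell_ginv e : cell (ginv e) = cell e.
Proof.
apply/seteqP; split=> x /cellP[u u01 <-]; apply/cellP.
  by exists (1 - u); [lra|rewrite gchar_ginv //; lra].
by exists (1 - u); [lra|rewrite gchar_ginv; [congr gchar|]; lra].
Qed.

Lemma ginv_inj : injective (@ginv R G).
Proof. exact: (can_inj (@ginvK R G)). Qed.

Lemma cell_eq e e' x : cell e x -> cell e' x -> e' = e \/ e' = ginv e.
Proof. exact: gcell_disj. Qed.

(** A homeomorphism onto an open edge together with its direction, encoded by one real function. The
    identity is demanded on the closed interval, so that the ends are known to go to vertices. *)
Definition piece phi a c e g : Prop :=
  [/\ a < c, ramp a c 1 g & forall u, a <= u <= c -> phi u = gchar e (g u)].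

Lemma piece_inner phi a c e g : piece phi a c e g ->
  forall u, a < u < c -> cell e (phi u).
Proof.
move=> [ac gP gE] u uac; rewrite gE; last lra.
exact/gchar_cell/(ramp_inner gP).
Qed.

Lemma piece_novert phi a c e g : piece phi a c e g ->
  forall u, a < u < c -> ~ gvert (phi u).
Proof. by move=> P u uac /(@gvert_cell _ _ e); apply; exact: piece_inner P _ uac. Qed.

Lemma piece_vert phi a c e g : piece phi a c e g -> gvert (phi a) /\ gvert (phi c).
Proof.
move=> [ac [_ g0 g1 _ _] gE]; split.
  by rewrite gE ?lexx ?ltW // g0 //; apply: gchar_vert; left.
by rewrite gE ?lexx ?ltW // g1 //; apply: gchar_vert; right.
Qed.

(** The ends of one interval go to vertices, hence are not interior to the other, so overlapping
    intervals coincide. The edges can then differ only in direction, and [e' = ginv e] would give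
    [g = 1 - g'] with both functions increasing. *)
Lemma piece_unique phi a c e g a' c' e' g' u :
  piece phi a c e g -> piece phi a' c' e' g' -> a < u < c -> a' < u < c' ->
  [/\ a = a', c = c', e = e' & g =1 g'].
Proof.
move=> P P' uac uac'.
have le_l a1 c1 e1 g1 a2 c2 e2 g2 : piece phi a1 c1 e1 g1 ->
    piece phi a2 c2 e2 g2 -> a1 < u < c1 -> a2 < u < c2 -> a1 <= a2 /\ c2 <= c1.
  move=> P1 P2 u1 u2; split; rewrite leNgt; apply/negP => lt.
    by apply: (piece_novert P2 _ (proj1 (piece_vert P1))); lra.
  by apply: (piece_novert P2 _ (proj2 (piece_vert P1))); lra.
have [aa' cc'] := le_l _ _ _ _ _ _ _ _ P P' uac uac'.
have [a'a c'c] := le_l _ _ _ _ _ _ _ _ P' P uac' uac.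
have {aa' a'a} aE : a = a' by apply/eqP; rewrite eq_le aa'.
have {cc' c'c} cE : c = c' by apply/eqP; rewrite eq_le c'c.
subst a' c'; have [ac gP gE] := P; have [_ gP' gE'] := P'.
have := cell_eq (piece_inner P uac) (piece_inner P' uac).
case=> e'E; subst e'.
  split=> // w; have [_ g0 g1 _ _] := gP; have [_ g0' g1' _ _] := gP'.
  have [wa|aw] := leP w a; first by rewrite g0 // g0'.
  have [cw|wc] := leP c w; first by rewrite g1 // g1'.
  apply: (@gchar_inj e); [by apply: (ramp_inner gP); rewrite aw| |].
    by apply: (ramp_inner gP'); rewrite aw.
  by rewrite -gE ?gE' // !ltW.
have rel w : a < w < c -> g w = 1 - g' w.
  move=> wac; have g'w := ramp_inner gP' wac.
  apply: (@gchar_inj e); [exact: (ramp_inner gP)|lra|].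
  by rewrite -gchar_ginv -?gE -?gE' //; lra.
have [_ _ _ g_incr _] := gP; have [_ _ _ g_incr' _] := gP'.
pose w := (u + c) / 2; have wac : a < w < c by rewrite /w; lra.
have := g_incr u w; have := g_incr' u w; rewrite !rel // /w; lra.
Qed.

Lemma piece_rev phi a c e g : piece phi a c e g ->
  piece (fun u => phi (1 - u)) (1 - c) (1 - a) (ginv e) (fun u => 1 - g (1 - u)).
Proof.
move=> [ac gP gE]; split; [lra|exact: ramp_rev|].
move=> u uac; have rng := ramp_range gP ler01 (1 - u).
by rewrite gE; [rewrite gchar_ginv; [congr gchar|]|]; lra.
Qed.

Lemma piece_ginv (f : G -> G) a c e e' g : 0 <= a -> c <= 1 ->
  piece (f \o gchar e) a c e' g ->
  piece (f \o gchar (ginv e)) (1 - c) (1 - a) (ginv e') (fun u => 1 - g (1 - u)).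
Proof.
move=> a0 c1 /piece_rev[ca gP gE]; split=> // u uac.
by rewrite -gE //= gchar_ginv //; lra.
Qed.

Lemma piece_comp psi phi a c e a1 c1 e1 g g1 h : piece phi a c e g ->
  (forall y, a <= h y <= c) -> (forall y, 0 <= y <= 1 -> g (h y) = y) ->
  0 <= a1 -> c1 <= 1 -> piece (psi \o gchar e) a1 c1 e1 g1 ->
  piece (psi \o phi) (h a1) (h c1) e1 (g1 \o g).
Proof.
move=> [ac gP gE] hac hK a10 c11 [ac1 g1P g1E].
have gc1 : g (h c1) = c1 by apply: hK; lra.
have ga1 : g (h a1) = a1 by apply: hK; lra.
have [g_homo _ _ _ _] := gP; split.
- rewrite ltNge; apply/negP => /g_homo; rewrite gc1 ga1; lra.
- exact: (ramp_comp gP).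
- move=> u /andP[au uc] /=.
  have [] := (hac a1, hac c1) => /andP[? ?] /andP[? ?].
  rewrite gE; last lra.
  by apply: g1E; rewrite -{1}ga1 -gc1 !g_homo.
Qed.

End Cells.

Section Chains.
Variables (R : realType) (E : eqType).
Implicit Types (Q : R -> R -> E -> Prop) (a b c u : R) (p : seq E).

(* [p] lists the edges attached by [Q] to the consecutive intervals of a
   subdivision of [a, b]. *)
Fixpoint chain Q a b p : Prop :=
  match p with
  | [::] => a = b
  | e :: p' => exists c, [/\ a < c, Q a c e & chain Q c b p']
  end.

Lemma chain_le Q a b p : chain Q a b p -> a <= b.
Proof.
elim: p a => [a <-//|e p IH a [c [ac _ /IH]]]; exact/le_trans/ltW.
Qed.

Lemma chain_cat Q a b c p p' :
  chain Q a b p -> chain Q b c p' -> chain Q a c (p ++ p').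
Proof.
elim: p a => [a <-//|e p IH a [d [ad Qd dp]] p'c].
by exists d; split=> //; exact: IH.
Qed.

Lemma chain_bind Q Q' (F : E -> seq E) a b p : chain Q a b p ->
  (forall a' c' e, a <= a' -> c' <= b -> a' < c' -> Q a' c' e -> chain Q' a' c' (F e)) ->
  chain Q' a b (flatten (map F p)).
Proof.
elim: p a => [//|e p IH] a [c [ac Qc cp]] H /=.
have cb := chain_le cp.
apply: chain_cat (IH _ cp _); first exact: H.
by move=> a' c' e' ca'; apply: H; exact: le_trans (ltW ac) ca'.
Qed.

Lemma chain_impl Q Q' a b p : chain Q a b p ->
  (forall a' c' e, a <= a' -> c' <= b -> a' < c' -> Q a' c' e -> Q' a' c' e) ->
  chain Q' a b p.
Proof.
elim: p a => [//|e p IH] a [c [ac Qc cp]] H; exists c; split=> //.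
  by apply: H => //; exact: chain_le cp.
by apply: (IH _ cp) => a' c' e' ca'; apply: H; exact: le_trans (ltW ac) ca'.
Qed.

Lemma chain_locate Q a b p u : chain Q a b p -> a <= u <= b -> a < b ->
  exists a' c' e, [/\ [/\ a <= a', c' <= b, a' < c' & a' <= u <= c'], Q a' c' e & e \in p].
Proof.
elim: p a => [a -> _|e p IH a [c [ac Qc cp]] /andP[au ub] ab].
  by rewrite ltxx.
have cb := chain_le cp.
have [uc|cu] := leP u c.
  by exists a, c, e; rewrite mem_head au uc lexx.
have cub : c <= u <= b by rewrite ltW.
have [a' [c' [e' [[ca' c'b ac' uac'] Q' e'p]]]] := IH c cp cub (lt_le_trans cu ub).
exists a', c', e'; rewrite inE e'p orbT; split=> //; split=> //.
exact: le_trans (ltW ac) ca'.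
Qed.

Lemma chain_index Q a b p e0 : chain Q a b p -> exists t : nat -> R,
  [/\ t 0 = a, t (size p) = b &
      forall i, (i < size p)%N -> t i < t i.+1 /\ Q (t i) (t i.+1) (nth e0 p i)].
Proof.
elim: p a => [a <-|e p IH a [c [ac Qc /IH[t [t0 t1 tQ]]]]].
  by exists (fun=> a).
exists (fun i => if i is j.+1 then t j else a); split=> // -[_|i /tQ//] /=.
by rewrite t0.
Qed.

Lemma index_chain Q p (t : nat -> R) e0 :
  (forall i, (i < size p)%N -> t i < t i.+1 /\ Q (t i) (t i.+1) (nth e0 p i)) ->
  chain Q (t 0) (t (size p)) p.
Proof.
elim: p t => [//|e p IH] t H /=; exists (t 1%N); have [] := H 0%N isT.
by split=> //; apply: (IH (t \o S)) => i ip; exact: (H i.+1).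
Qed.

End Chains.

Lemma chain_map (R : realType) (E : eqType) (Q Q' : R -> R -> E -> Prop)
    (h : R -> R) a b p : chain Q a b p ->
  (forall a' c' e, a <= a' -> c' <= b -> a' < c' -> Q a' c' e ->
     h a' < h c' /\ Q' (h a') (h c') e) ->
  chain Q' (h a) (h b) p.
Proof.
elim: p a => [a -> //|e p IH] a [c [ac Qc cp]] H.
have [hac Qh] := H a c e (lexx a) (chain_le cp) ac Qc.
exists (h c); split=> //; apply: IH => // a' c' e' ca'.
by apply: H; exact: le_trans (ltW ac) ca'.
Qed.

Lemma chain_rev (R : realType) (E : eqType) (inv : E -> E)
    (Q Q' : R -> R -> E -> Prop) a b p : chain Q a b p ->
  (forall a' c' e, a <= a' -> c' <= b -> Q a' c' e -> Q' (1 - c') (1 - a') (inv e)) ->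
  chain Q' (1 - b) (1 - a) (rev (map inv p)).
Proof.
elim: p a => [a -> //|e p IH] a [c [ac Qc cp]] H.
rewrite /= rev_cons -cats1; apply: chain_cat (IH c cp _) _.
  by move=> a' c' e' ca'; apply: H; exact: le_trans (ltW ac) ca'.
exists (1 - a); split=> //; first by rewrite ltrD2l ltrN2.
by apply: H => //; exact: chain_le cp.
Qed.

(** * Edge-paths as chains of crossings *)


Lemma within_comp (X Y Z : topologicalType) (A : set X) (B : set Y)
    (f : X -> Y) (k : Y -> Z) : {within A, continuous f} ->
  {within B, continuous k} -> (forall x, A x -> B (f x)) ->
  {within A, continuous (k \o f)}.
Proof.
move=> /subspace_continuousP fc /subspace_continuousP kc AB.
apply/subspace_continuousP => x Ax.
apply: (@cvg_comp _ _ _ f k _ (within B (nbhs (f x)))); last exact/kc/AB.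
move=> S nS; have : (f z @[z --> within A (nbhs x)]) [set y | B y -> S y] := fc x Ax _ nS.
by rewrite /nbhs /= /within /=; apply: filterS => z zS Az; exact: zS (AB z Az).
Qed.

Lemma within_continuous_comp (X Y Z : topologicalType) (A : set X)
    (f : X -> Y) (k : Y -> Z) :
  {within A, continuous f} -> continuous k -> {within A, continuous (k \o f)}.
Proof.
by move=> fc kc; apply: (@within_comp _ _ _ A setT) => //; exact: continuous_subspaceT.
Qed.

Section EdgeImages.
Variables (R : realType) (G : tgraph R).
Implicit Types (e : gedge G) (s t u w a c : R) (phi : R -> G) (h : G -> G)
  (p q : seq (gedge G)).

Definition crosses phi a c e : Prop := exists g, piece phi a c e g.

(** Two first pieces with the same origin overlap just to the right of [a], hence agree, and so on
    along the path. This makes the choice in [epath] harmless. *)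
Lemma crosses_chain_unique phi a b p q :
  chain (crosses phi) a b p -> chain (crosses phi) a b q -> p = q.
Proof.
elim: p a q => [|e p IH] a [|e' q] //=.
- by move=> -> [c [bc _ /chain_le]]; rewrite leNgt bc.
- by move=> + ba; rewrite ba => -[c [bc _ /chain_le]]; rewrite leNgt bc.
move=> [c [ac [g P] cp]] [c' [ac' [g' P'] cq]].
pose u := (a + Num.min c c') / 2.
have acc : a < Num.min c c' by rewrite lt_min ac.
have [mc mc'] : Num.min c c' <= c /\ Num.min c c' <= c'.
  by rewrite !ge_min !lexx orbT.
have uac : a < u < c by rewrite /u; lra.
have uac' : a < u < c' by rewrite /u; lra.
have [_ cc' ee' _] := piece_unique P P' uac uac'.
by subst c' e'; rewrite (IH c q).
Qed.

(** The image point, read in the parameter of [e'], is increasing by the order clause and onto by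
    the image clause, as [ramp_extend] requires; the end values follow by continuity. *)
Lemma maps_onto_edge_crosses h e s t e' : continuous h ->
  0 <= s -> s < t -> t <= 1 -> maps_onto_edge h e s t e' ->
  crosses (h \o gchar e) s t e'.
Proof.
move=> h_cont s0 st t1 [[himg _ _] hlt].
have [gam [_ gamK]] := gchar_coord e'.
pose sig u := gam (h (gchar e u)).
have sigE u : s < u < t -> 0 < sig u < 1 /\ h (gchar e u) = gchar e' (sig u).
  move=> /andP[su ut]; have : cell e' (h (gchar e u)).
    by rewrite -himg; exists (gchar e u) => //; exists u => //; rewrite /= in_itv /= su.
  by move=> /cellP[y y01 yE]; rewrite /sig -yE gamK.
have [||||g [gP gE]] := @ramp_extend R s t 1 sig st.
- exact: ltr01.
- move=> u w su uw wt; have [x [y [x0 xy y1 xE yE]]] := hlt u w su uw wt.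
  by rewrite /sig -xE -yE !gamK //; lra.
- by move=> u /sigE[].
- move=> y y01; have : cell e' (gchar e' y) by exact: gchar_cell.
  rewrite -himg => -[_ [u + <-]]; rewrite /= in_itv /= => ust uE.
  by exists u => //; rewrite /sig uE gamK.
exists g; split=> // u ust.
have [_ _ _ _ g_cont] := gP.
have : (h \o echar e) u = (echar e' \o g) u.
  apply: (@continuous_eq_segment R G _ _ s t) => //.
  - exact: ghausdorff.
  - by move=> w; apply: continuous_comp; [exact: echar_continuous|exact: h_cont].
  - by move=> w; apply: continuous_comp; [exact: g_cont|exact: echar_continuous].
  - move=> w wst; have [s01 sE] := sigE w wst.
    by rewrite /= !echarE ?gE //; lra.
by rewrite /= !echarE //; [exact: (ramp_range gP)|lra].
Qed.

Lemma piece_homeo h e s t e' g : continuous h -> 0 <= s -> t <= 1 ->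
  piece (h \o gchar e) s t e' g ->
  homeo_on (gchar e @` `]s, t[) (cell e') h.
Proof.
move=> h_cont s0 t1 P; have [st gP gE] := P; split.
- apply/seteqP; split=> [_ [_ [u + <-] <-]|x /cellP[y y01 <-]].
    by rewrite /= in_itv /=; exact: piece_inner P _.
  have [|u ust guy] := ramp_surj gP st (y := y); first lra.
  exists (gchar e u); last by rewrite -guy; exact: gE.
  by exists u => //; rewrite /= in_itv /=; apply: (ramp_inner_inv gP); rewrite guy.
- exact: continuous_subspaceT.
- have [gam [gam_cont gamK]] := gchar_coord e'.
  have [k [k_cont gK k_rng kK]] := ramp_inv gP st.
  exists (echar e \o (k \o gam)); split.
    apply: within_continuous_comp; last exact: echar_continuous.
    exact: within_continuous_comp.
  move=> _ [u + <-]; rewrite /= in_itv /= => ust.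
  have ust' : s <= u <= t by lra.
  have := gE u ust'; rewrite /= => ->; rewrite gamK; last exact: ramp_inner ust.
  by rewrite gK // echarE //; lra.
Qed.

Lemma crosses_maps_onto_edge h e s t e' : continuous h -> 0 <= s -> t <= 1 ->
  crosses (h \o gchar e) s t e' -> maps_onto_edge h e s t e'.
Proof.
move=> h_cont s0 t1 [g P]; split; first exact: piece_homeo P.
have [st gP gE] := P; move=> u w su uw wt; exists (g u), (g w).
have ust : s < u < t by lra.
have wst : s < w < t by lra.
have /andP[? ?] := ramp_inner gP ust; have /andP[? ?] := ramp_inner gP wst.
have [_ _ _ g_incr _] := gP.
split=> //; first by apply: g_incr; lra.
  by rewrite -gE //; lra.
by rewrite -gE //; lra.
Qed.

Lemma edge_image_index h e p : continuous h -> p <> [::] -> edge_image h e p ->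
  exists (t : nat -> R) (g : nat -> R -> R),
    [/\ t 0 = 0, t (size p) = 1 & forall i, (i < size p)%N ->
      [/\ 0 <= t i, t i.+1 <= 1 &
          piece (h \o gchar e) (t i) (t i.+1) (nth e p i) (g i)]].
Proof.
move=> h_cont p0 [[//]|[t [t0 t1 tP]]].
have t_le i j : (i <= j)%N -> (j <= size p)%N -> t i <= t j.
  elim: j => [|j IH]; first by rewrite leqn0 => /eqP ->.
  rewrite leq_eqVlt => /predU1P[->//|ij] jn.
  by apply: (le_trans (IH ij (ltnW jn))); have [/ltW] := tP _ jn.
have gex i : exists g : R -> R, (i < size p)%N ->
    piece (h \o gchar e) (t i) (t i.+1) (nth e p i) g.
  have [ip|] := ltnP i (size p); last by exists id.
  have [tt tm] := tP i ip.
  have l0 : 0 <= t i by rewrite -t0; apply: t_le => //; exact: ltnW.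
  have l1 : t i.+1 <= 1 by rewrite -t1; exact: t_le.
  have [g P] := maps_onto_edge_crosses h_cont l0 tt l1 tm.
  by exists g.
have [g gP] := choice gex.
exists t, g; split=> // i ip; split; last exact: gP.
  by rewrite -t0; apply: t_le => //; exact: ltnW.
by rewrite -t1; exact: t_le.
Qed.

Lemma chain_edge_image h e p : continuous h ->
  chain (crosses (h \o gchar e)) 0 1 p -> edge_image h e p.
Proof.
move=> h_cont ch; right.
have ch' : chain (maps_onto_edge h e) 0 1 p.
  apply: chain_impl ch _ => a c e' a0 c1 _; exact: crosses_maps_onto_edge.
by have [t tP] := chain_index e ch'; exists t.
Qed.

Lemma edge_image_chain h e p : continuous h -> p <> [::] -> edge_image h e p ->
  chain (crosses (h \o gchar e)) 0 1 p.
Proof.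
move=> h_cont p0 /(edge_image_index h_cont p0)[t [g [<- <- tP]]].
apply: (@index_chain _ _ _ p t e) => i /tP[_ _ P]; split; last by exists (g i).
by case: P.
Qed.

(** A non-empty path selected by [epath] is determined by uniqueness of chains. An empty one would
    mean [0 = 1], or that the whole open cell goes to a vertex, although the midpoint of a piece
    goes inside an edge. *)
Lemma epath_chain h e p : continuous h ->
  chain (crosses (h \o gchar e)) 0 1 p -> epath h e = p.
Proof.
move=> h_cont ch; have ep := chain_edge_image h_cont ch.
rewrite /epath; case: xgetP => [q _ eq|/(_ p)//].
have [q0|q0] := pselect (q = [::]); last first.
  by apply: crosses_chain_unique ch; exact: edge_image_chain.
case: eq => [[_ [v vv hv]]|[t [t0 t1 _]]]; last first.
  by move: t1; rewrite q0 /= t0 => /esym/eqP; rewrite oner_eq0.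
clear q0; exfalso; clear q.
have half : 0 <= (2^-1 : R) <= 1 by lra.
have [a [c [e' [[a0 c1 ac _] [g P] _]]]] := chain_locate ch half ltr01.
have mid : a < (a + c) / 2 < c by lra.
have := piece_novert P mid; rewrite /= hv //.
by apply: gchar_cell; lra.
Qed.

End EdgeImages.

(** * Iterates *)


Section Subcells.
Variables (R : realType) (G : tgraph R).
Implicit Types (e : gedge G) (s t u : R).

Lemma echar_segment_closed e s t : closed (echar e @` `[s, t]).
Proof.
apply: compact_closed; first exact: ghausdorff.
apply: continuous_compact; last exact: segment_compact.
exact/continuous_subspaceT/echar_continuous.
Qed.

(** The vertices, the two remaining closed parts of [e] and the other closed edges are finitely many
    closed sets that cover the complement of the subcell and miss the point. Openness is thus
    derived from finiteness and the Hausdorff property. *)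
Lemma subcell_nbhs e s u t : 0 <= s -> s < u -> u < t -> t <= 1 ->
  nbhs (gchar e u) (gchar e @` `]s, t[).
Proof.
move=> s0 su ut t1.
pose C : set G := @gvert R G `|` (echar e @` `[0, s] `|` (echar e @` `[t, 1] `|`
  \bigcup_(e' in [set e' : gedge G | e' != e /\ e' != ginv e]) (echar e' @` `[0, 1]))).
have C_closed : closed C.
  apply: closedU.
    have /accessible_finite_set_closed := hausdorff_accessible (@ghausdorff R G).
    by apply; exact: gvert_finite.
  apply: closedU; first exact: echar_segment_closed.
  apply: closedU; first exact: echar_segment_closed.
  apply: closed_bigcup; first exact: finite_finset.
  by move=> e' _; exact: echar_segment_closed.
have u01 : 0 < u < 1 by lra.
have nCu : ~ C (gchar e u).
  have echar_cell w e' : 0 <= w <= 1 -> echar e' w = gchar e u ->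
      0 < w < 1 /\ gchar e' w = gchar e u.
    move=> w01; rewrite echarE // => wu; split=> //.
    have [w0|w0] := eqVneq w 0.
      by case: (@gchar_novert _ _ e u u01); rewrite -wu; apply: gchar_vert; left.
    have [w1|w1] := eqVneq w 1.
      by case: (@gchar_novert _ _ e u u01); rewrite -wu; apply: gchar_vert; right.
    by rewrite !lt_neqAle eq_sym w0 w1.
  case=> [|[|[|]]].
  - exact: gchar_novert.
  - move=> [w + wu]; rewrite /= in_itv /= => ws.
    have [|w01 wE] := echar_cell w e _ wu; first lra.
    by have := gchar_inj w01 u01 wE; lra.
  - move=> [w + wu]; rewrite /= in_itv /= => ws.
    have [|w01 wE] := echar_cell w e _ wu; first lra.
    by have := gchar_inj w01 u01 wE; lra.
  - move=> [e' [e'e e'i] [w + wu]]; rewrite /= in_itv /= => ws.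
    have [//|w01 wE] := echar_cell w e' _ wu.
    have := gchar_cell e' w01; rewrite wE => /(cell_eq (gchar_cell e u01)).
    by case=> /eqP; apply/negP.
have /filterS := open_nbhs_nbhs (conj (closed_openC C_closed) nCu); apply.
move=> x /= nCx; have [xv|[e' xe']] := gcover x; first by case: nCx; left.
have in_e : cell e x -> (gchar e @` `]s, t[) x.
  move=> /cellP[w w01 wE]; exists w => //=; rewrite in_itv /=.
  apply/andP; split; rewrite ltNge; apply/negP => le.
    by apply: nCx; right; left; exists w; [rewrite /= in_itv /=; lra|rewrite echarE //; lra].
  apply: nCx; right; right; left.
  by exists w; [rewrite /= in_itv /=; lra|rewrite echarE //; lra].
have [e'e|e'e] := eqVneq e' e; first by apply: in_e; rewrite -e'e.
have [e'i|e'i] := eqVneq e' (ginv e).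
  by apply: in_e; rewrite -(cell_ginv e) -e'i.
case: nCx; right; right; right; exists e' => //.
have /cellP[w w01 wE] := xe'; exists w; first by rewrite /= in_itv /=; lra.
by rewrite echarE //; lra.
Qed.

End Subcells.

Section Iterates.
Variables (R : realType) (G : tgraph R) (f : G -> G).
Hypotheses (f_map : graph_map f) (f_reg : regular_map f).
Implicit Types (e : gedge G) (u a c : R) (m : nat).

Local Notation F := (epath f).

Lemma epath_neq0 e : F e <> [::].
Proof. by have [+ _] := f_reg e; case: (F e). Qed.

Lemma epath_image e : edge_image f e (F e).
Proof. by have [_ _ /(_ e) ex] := f_map; exact: (xgetPex [::] ex). Qed.

Lemma iter_continuous m : continuous (iter m f).
Proof.
have [f_cont _ _] := f_map.
elim: m => [|m IH] x; first exact: cvg_id.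
by apply: (@continuous_comp _ _ _ (iter m f) f); [exact: IH|exact: f_cont].
Qed.

Definition path_iter m e := iter m (fun p => flatten (map F p)) [:: e].

(** A crossing along which the source coordinate [d] grows by [lam] times the target coordinate
    [D e]. It is used with [lam] the inverse of the stretching factor, and with [D = 0] for bare
    crossings. *)
Definition scales (lam : R) (D : gedge G -> R -> R) (phi : R -> G) (d : R -> R) a c e :=
  exists g, piece phi a c e g /\
    forall u, a <= u <= c -> d u = d a + lam * D e (g u).

(** Each piece for [iter m f] is refined by the subdivision for [f] of its target edge, transported
    by the inverse [h] of its ramp; the length factors multiply. *)
Lemma iter_chain_scales lam D : (forall e, D e 0 = 0) ->
  (forall e, chain (scales lam D (f \o gchar e) (D e)) 0 1 (F e)) ->
  forall m e, chain (scales (lam ^+ m) D (iter m f \o gchar e) (D e)) 0 1 (path_iter m e).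
Proof.
move=> D0 DF m e; elim: m => [|m IH].
  exists 1; split=> //.
  exists (clamp 0 1); split; first split.
  - exact: ltr01.
  - exact: ramp_clamp.
  - by move=> u u01 /=; rewrite clamp_id.
  - by move=> u u01; rewrite D0 add0r mul1r clamp_id.
apply: chain_bind IH _ => a c e' a0 c1 ac [g [P gD]].
have [_ gP gE] := P; have [h [h_cont gK h_rng hK]] := ramp_inv gP ac.
have [_ g0 g1 _ _] := gP.
have ha : h 0 = a by rewrite -(g0 a) // gK // lexx ltW.
have hc : h 1 = c by rewrite -(g1 c) // gK // lexx ltW.
(* Writing the ends as values of [h] exhibits the piece as the image of [[0, 1]], where the
   subdivision of [e'] lives. *)
have <- : h 0 = a by [].
have <- : h 1 = c by [].
apply: chain_map (DF e') _ => a1 c1' x a10 c11 ac1 [g1' [P1 g1D]].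
have P' := piece_comp P h_rng hK a10 c11 P1.
split; first by case: P'.
exists (g1' \o g); split=> // u uac.
have [] := (h_rng a1, h_rng c1') => /andP[? ?] /andP[? ?].
have gha : g (h a1) = a1 by apply: hK; lra.
have ghc : g (h c1') = c1' by apply: hK; lra.
have gu : a1 <= g u <= c1'.
  by have [g_homo _ _ _ _] := gP; rewrite -{1}gha -ghc !g_homo //; lra.
rewrite gD ?(gD (h a1)) ?gha ?(g1D _ gu) ?exprSr /=; first ring.
all: lra.
Qed.

Lemma epath_crosses e : chain (crosses (f \o gchar e)) 0 1 (F e).
Proof.
have [f_cont _ _] := f_map.
exact: edge_image_chain f_cont (@epath_neq0 e) (epath_image e).
Qed.

Lemma iter_chain_crosses m e : chain (crosses (iter m f \o gchar e)) 0 1 (path_iter m e).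
Proof.
(* For [D = 0] the condition on lengths in [scales] is void. *)
have H e' : chain (scales 1 (fun=> cst 0) (f \o gchar e') (cst 0)) 0 1 (F e').
  apply: chain_impl (epath_crosses e') _ => a c x _ _ _ [g P].
  by exists g; split=> // u _ /=; rewrite mulr0 addr0.
apply: chain_impl (iter_chain_scales (fun=> erefl) H m e) _.
by move=> a c x _ _ _ [g [P _]]; exists g.
Qed.

Lemma epath_iter m e : epath (iter m f) e = path_iter m e.
Proof. exact: epath_chain (@iter_continuous m) (iter_chain_crosses m e). Qed.

Hypothesis f_exp : expanding_on_all_scales f.

(* An interval [W] that [iter m f] maps homeomorphically onto an open edge meets no
   preimage of a vertex, so it lies in a single interval of the subdivision, which
   it must fill. *)
Lemma scale_piece e s t e1 : 0 <= s -> s < t -> t <= 1 ->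
  exists m, (0 < m)%N /\ forall (Q : R -> R -> gedge G -> Prop) P,
    (forall a c e', Q a c e' -> crosses (iter m f \o gchar e) a c e') ->
    chain Q 0 1 P -> exists a c e',
      [/\ [/\ a < c, s <= a & c <= t], Q a c e', e' = e1 \/ e' = ginv e1 & e' \in P].
Proof.
move=> s0 st t1; pose x := gchar e ((s + t) / 2).
have nU : nbhs x (gchar e @` `]s, t[) by apply: subcell_nbhs => //; lra.
have [m [W [m0 _ WU [Wimg _ [k [k_cont kK]]]]]] := f_exp e1 nU.
exists m; split=> // Q P QP ch.
have [gam [gam_cont gamK]] := gchar_coord e.
(* [psi w] is the position on [e] of the point of [W] sent to position [w] of [e1]. By continuity
   its values form an interval, which contains no position sent to a vertex. *)
pose psi := gam \o (k \o echar e1).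
have psiP w : 0 < w < 1 -> exists u, [/\ s < u < t, k (echar e1 w) = gchar e u,
    psi w = u & iter m f (gchar e u) = gchar e1 w].
  move=> w01; have := gchar_cell e1 w01; rewrite -Wimg => -[y Wy yE].
  have [u + uE] := WU y Wy; rewrite /= in_itv /= => ust.
  exists u; split=> //; last by rewrite uE.
    by rewrite echarE ?lt_bnd_le -?yE ?kK //; lra.
  by rewrite /psi /= echarE -?yE ?kK // -?uE ?gamK //; lra.
have psi_cont : {within `]0, 1[%classic, continuous psi}.
  apply: (@within_comp _ _ _ _ (cell e)) => //; last first.
    move=> w; rewrite /= in_itv /= => /psiP[u [ust -> _ _]].
    by apply: gchar_cell; lra.
  apply: (@within_comp _ _ _ _ (cell e1)) => //; last first.
    move=> w; rewrite /= in_itv /= => w01; rewrite echarE; last lra.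
    exact: gchar_cell.
  exact/continuous_subspaceT/echar_continuous.
have psi_itv : is_interval (psi @` `]0, 1[).
  apply/connected_intervalP/connected_continuous_connected => //.
  exact/connected_intervalP/interval_is_interval.
have half : 0 < (2^-1 : R) < 1 by lra.
have [u0 [u0st _ psi0 u0E]] := psiP _ half.
have u001 : 0 <= u0 <= 1 by lra.
have [a [c [e' [[a0 c1 ac u0ac] Qac e'P]]]] := chain_locate ch u001 ltr01.
have [g Pg] := QP _ _ _ Qac.
have no_end z : gvert (iter m f (gchar e z)) -> ~ (psi @` `]0, 1[) z.
  move=> vz [w + wz]; rewrite /= in_itv /= => w01; have [u [_ _ uw uE]] := psiP w w01.
  by move: vz; rewrite -wz uw uE; exact: gchar_novert.
have [va vc] := piece_vert Pg.
have psi_half : (psi @` `]0, 1[) u0 by exists 2^-1 => //; rewrite /= in_itv.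
have psi_ac w : 0 < w < 1 -> a < psi w < c.
  move=> w01; have psi_w : (psi @` `]0, 1[) (psi w) by exists w => //; rewrite /= in_itv.
  apply/andP; split; rewrite ltNge; apply/negP => le.
    by apply: (no_end _ va); apply: (psi_itv _ _ psi_w psi_half); lra.
  by apply: (no_end _ vc); apply: (psi_itv _ _ psi_half psi_w); lra.
have gE w : 0 < w < 1 -> gchar e1 w = gchar e' (g (psi w)).
  move=> w01; have [u [_ _ uw uE]] := psiP w w01.
  have := psi_ac w w01; rewrite uw => uac.
  by have [_ _ H] := Pg; rewrite -uE; apply: H; lra.
have [ac' gP _] := Pg.
have gpsi01 w : 0 < w < 1 -> 0 < g (psi w) < 1 by move=> /psi_ac /(ramp_inner gP).
have e'E : e' = e1 \/ e' = ginv e1.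
  apply: (@cell_eq _ _ _ _ (gchar e1 2^-1)); first exact: gchar_cell.
  by rewrite gE //; apply: gchar_cell; exact: gpsi01.
(* When [e'] runs against [e1], the parameter is reversed. *)
have g_onto y : 0 < y < 1 -> exists2 w, 0 < w < 1 & g (psi w) = y.
  move=> y01; case: e'E => e'E; subst e'.
    by exists y => //; apply: (@gchar_inj _ _ e1); rewrite ?gpsi01 // -gE.
  have w01 : 0 < 1 - y < 1 by lra.
  exists (1 - y) => //; have gw := gpsi01 _ w01.
  suff : 1 - y = 1 - g (psi (1 - y)) by lra.
  apply: (@gchar_inj _ _ e1) => //; first lra.
  by rewrite gE // gchar_ginv //; lra.
(* [W] alone covers the target edge and the piece is injective, so every interior position of the
   piece comes from [W], which lies over []s, t[]. *)
have inside z : a < z < c -> s < z < t.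
  move=> zac; have [w w01 gw] := g_onto _ (ramp_inner gP zac).
  have [u [ust _ uw _]] := psiP w w01.
  suff -> : z = psi w by rewrite uw.
  by apply: (ramp_inj gP); [lra|have := psi_ac w w01; lra|].
exists a, c, e'; split=> //; split=> //; rewrite leNgt; apply/negP => lt.
  (* The midpoint of an overhang to the left of [s] would be interior to the piece but outside []s,
     t[]; similarly on the right of [t]. *)
  pose z := (a + Num.min s c) / 2.
  have : Num.min s c <= s /\ Num.min s c <= c by rewrite !ge_min !lexx orbT.
  have : a < Num.min s c by rewrite lt_min lt.
  move=> H [? ?]; have : s < z < t by apply: inside; rewrite /z; lra.
  rewrite /z; lra.
pose z := (c + Num.max t a) / 2.
have : t <= Num.max t a /\ a <= Num.max t a by rewrite !le_max !lexx orbT.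
have : Num.max t a < c by rewrite gt_max lt.
move=> H [? ?]; have : s < z < t by apply: inside; rewrite /z; lra.
rewrite /z; lra.
Qed.

End Iterates.

(** * The transition matrix *)


Section Transitions.
Variables (R : realType) (G : tgraph R) (f : G -> G).
Hypotheses (f_map : graph_map f) (f_reg : regular_map f)
  (f_exp : expanding_on_all_scales f).
Variables (Ep : {set gedge G}) (n : nat) (e_ : 'I_n -> gedge G).
Hypotheses (Ep_or : orientation Ep) (e_inj : injective e_)
  (e_Ep : forall e, (e \in Ep) = (e \in codom e_)).
Implicit Types (e x : gedge G) (i j : 'I_n) (m : nat) (p : seq (gedge G)).

Local Notation F := (epath f).
Local Notation A := (transition_matrix f e_).
Local Notation step := (fun p => flatten (map F p)).

Lemma epath_ginv e : F (ginv e) = rev (map (@ginv R G) (F e)).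
Proof.
have [f_cont _ _] := f_map; apply: epath_chain => //.
have := @chain_rev R _ (@ginv R G) _ (crosses (f \o gchar (ginv e))) 0 1 (F e)
  (epath_crosses f_map f_reg e).
rewrite subrr subr0; apply=> a c x a0 c1 [g /(piece_ginv a0 c1) P].
by exists (fun u => 1 - g (1 - u)).
Qed.

Lemma edge_index_exists : exists idx : gedge G -> 'I_n, forall e j,
  ((e == e_ j) || (e == ginv (e_ j))) = (idx e == j).
Proof.
have H e : exists i, e = e_ i \/ e = ginv (e_ i).
  have := Ep_or e; rewrite !e_Ep.
  case: (boolP (e \in codom e_)) => [/codomP[i ei] _|_ /codomP[i ei]]; exists i.
    by left.
  by right; rewrite -ei ginvK.
have e_ginv i j : e_ i <> ginv (e_ j).
  move=> ij; have := Ep_or (e_ j); rewrite -ij !e_Ep !codom_f.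
  by [].
have [idx idxP] := choice H; exists idx => e j.
apply/orP/eqP => [|<-]; last by case: (idxP e) => /eqP; [left|right].
case: (idxP e) => eE [] /eqP; rewrite {1}eE.
- exact: e_inj.
- by move=> /e_ginv.
- by move=> /esym/e_ginv.
- by move=> /(@ginv_inj R G)/e_inj.
Qed.

Lemma size_path_step p : (size p <= size (step p))%N.
Proof.
elim: p => //= x p IH; rewrite size_cat -add1n leq_add //.
by have [] := f_reg x.
Qed.

Lemma iter_step_cat m p p' : iter m step (p ++ p') = iter m step p ++ iter m step p'.
Proof. by elim: m => //= m ->; rewrite map_cat flatten_cat. Qed.

Lemma mem_path_iter m e x t y : x \in path_iter f m e -> y \in path_iter f t x ->
  y \in path_iter f (t + m) e.
Proof.
rewrite /path_iter iterD; move: (iter m step [:: e]) => p.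
case/splitPr => p1 p2 yt; rewrite -cat1s !iter_step_cat !mem_cat.
by rewrite yt !orbT.
Qed.

Lemma path_iter_hits e x : exists m y, [/\ (0 < m)%N, y = x \/ y = ginv x &
  y \in path_iter f m e].
Proof.
have [m [m0 H]] := scale_piece f_exp e x (lexx 0) ltr01 (lexx 1).
have [a [c [y [_ _ yx yp]]]] := H _ _ (fun _ _ _ cr => cr)
  (iter_chain_crosses f_map f_reg m e).
by exists m, y.
Qed.

Lemma exists_long_epath : exists e, (1 < size (F e))%N.
Proof.
apply: contrapT => /forallNP short.
have size1 e : size (F e) = 1%N.
  apply/eqP; rewrite eqn_leq; have [-> _] := f_reg e; rewrite andbT leqNgt.
  exact/negP/short.
have [e _] : exists e : gedge G, true by have /card_gt0P[e _] := gedge_gt0 G; exists e.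
have size_iter m : size (path_iter f m e) = 1%N.
  elim: m => //= m IH; rewrite /path_iter /= -/(path_iter f m e).
  by case: (path_iter f m e) IH => [//|x [|//]] _; rewrite /= cats0.
have l03 : 0 <= (3^-1 : R) by lra.
have l32 : (3^-1 : R) < 2^-1 by lra.
have l21 : (2^-1 : R) <= 1 by lra.
have [m [_ H]] := scale_piece f_exp e e l03 l32 l21.
have ch := iter_chain_crosses f_map f_reg m e.
case pE : (path_iter f m e) ch (size_iter m) => [//|x [|//]] [c [c0 cr c1]] _.
(* [Q] also records that the only piece is all of [[0, 1]], which is incompatible with a piece
   starting at [3^-1] or later. *)
pose Q a c x := [/\ crosses (iter m f \o gchar e) a c x, a = 0 & c = 1].
have Qx : chain Q 0 1 [:: x] by exists c; rewrite /Q c1; split=> //; rewrite -c1.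
have Qcr a c' e' : Q a c' e' -> crosses (iter m f \o gchar e) a c' e' by case.
have [a [c' [e' [[_ a13 _] [_ a0 _] _ _]]]] := H Q [:: x] Qcr Qx.
by move: a13; rewrite a0 leNgt invr_gt0 ltr0n.
Qed.

(** Every edge of the path eventually passes over one whose image has length at least 2; one further
    step then gains an edge, since no other edge disappears. *)
Lemma path_iter_unbounded e N : exists m, (N <= size (path_iter f m e))%N.
Proof.
elim: N => [|N [m mN]]; first by exists 0%N.
have [b b2] := exists_long_epath.
have [x xp] : exists x, x \in path_iter f m e.
  elim: m {mN} => [|m [x xp]]; first by exists e; rewrite mem_head.
  have : (0 < size (F x))%N by have [] := f_reg x.
  case E : (F x) => [//|y q] _; exists y; apply/flattenP; exists (F x).
    exact: map_f.
  by rewrite E mem_head.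
have [t [y [_ yb yp]]] := path_iter_hits x b.
have := mem_path_iter xp yp.
have y2 : (1 < size (F y))%N by case: yb => ->; rewrite ?epath_ginv ?size_rev ?size_map.
have : (N <= size (path_iter f (t + m) e))%N.
  rewrite /path_iter iterD -/(path_iter f m e).
  elim: t {yp} => //= t IH; apply: leq_trans IH _; exact: size_path_step.
move=> le_N yp'; exists (t + m).+1; rewrite /path_iter /= -/(path_iter f (t + m) e).
case/splitPr : yp' le_N => p1 p2; rewrite map_cat flatten_cat /= !size_cat /= => le_N.
apply: leq_ltn_trans le_N _; rewrite -addnS; apply: leq_add.
  exact: size_path_step.
by rewrite -[X in (X <= _)%N]/(2 + size p2)%N leq_add // size_path_step.
Qed.

Lemma regular_expanding : expanding f.
Proof.
move=> e; apply/cvgnyPge => N.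
have [m mN] := path_iter_unbounded e N.
exists m => // k /= mk; rewrite (epath_iter f_map f_reg).
apply: leq_trans mN _; rewrite -(subnK mk) /path_iter iterD.
elim: (k - m)%N => //= t IH; apply: leq_trans IH _; exact: size_path_step.
Qed.

Variable idx : gedge G -> 'I_n.
Hypothesis idxE : forall e j, ((e == e_ j) || (e == ginv (e_ j))) = (idx e == j).

Lemma idx_e_ i : idx (e_ i) = i.
Proof. by apply/eqP; rewrite -idxE eqxx. Qed.

Lemma idx_ginv e : idx (ginv e) = idx e.
Proof.
apply/eqP; rewrite -idxE (can2_eq (@ginvK R G) (@ginvK R G)).
by rewrite (inj_eq (@ginv_inj R G)) orbC idxE eqxx.
Qed.

Lemma idx_cases e : e = e_ (idx e) \/ e = ginv (e_ (idx e)).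
Proof. by have := eqxx (idx e); rewrite -idxE => /orP[]/eqP; [left|right]. Qed.

Definition occ j p : nat := count (fun x => idx x == j) p.

Lemma transition_matrixE i j : A i j = (occ j (F (e_ i)))%:R.
Proof. by rewrite mxE; congr (_%:R); apply: eq_count => x /=; rewrite idxE. Qed.

Lemma occ_epath e j : A (idx e) j = (occ j (F e))%:R.
Proof.
rewrite transition_matrixE; case: (idx_cases e) => {2}->; rewrite //.
rewrite epath_ginv /occ count_rev count_map; congr (_%:R).
by apply: eq_count => x /=; rewrite idx_ginv.
Qed.

Lemma occ_step p j : (occ j (step p))%:R = \sum_i (occ i p)%:R * A i j :> R.
Proof.
elim: p => [|x p IH].
  by rewrite big1 // => i _; rewrite mul0r.
rewrite /= /occ count_cat natrD -/(occ j (F x)) -/(occ j (step p)) IH.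
rewrite -occ_epath (bigD1 (idx x)) //= [RHS](bigD1 (idx x)) //= eqxx natrD.
rewrite mulrDl mul1r addrA; congr (_ + _); apply: eq_bigr => i ix.
by rewrite eq_sym (negbTE ix).
Qed.

Lemma transition_matrix_exp m i j : (A ^+ m) i j = (occ j (path_iter f m (e_ i)))%:R.
Proof.
elim: m j => [|m IH] j.
  by rewrite expr0 mxE /occ /= idx_e_ addn0.
rewrite exprSr -mulmxE mxE /path_iter /= -/(path_iter f m (e_ i)) occ_step.
by apply: eq_bigr => k _; rewrite IH.
Qed.

Lemma transition_matrix_irreducible : irreducible_mx A.
Proof.
move=> i j; have [m [y [m0 yj yp]]] := path_iter_hits (e_ i) (e_ j).
exists m; split=> //; rewrite transition_matrix_exp ltr0n -has_count.
apply/hasP; exists y => //; rewrite -idxE.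
by case: yj => ->; rewrite eqxx ?orbT.
Qed.

Lemma transition_matrix_ge0 i j : 0 <= A i j.
Proof. by rewrite transition_matrixE ler0n. Qed.

Lemma orientation_gt0 : (0 < n)%N.
Proof.
have [e _] : exists e : gedge G, true by have /card_gt0P[e _] := gedge_gt0 G; exists e.
exact: leq_ltn_trans (leq0n _) (ltn_ord (idx e)).
Qed.

Section Lengths.
Variables (lam : R) (v : 'cV[R]_n).
Hypotheses (v_gt0 : forall i, 0 < v i 0) (Av : A *m v = lam *: v).

Lemma sum_occ p : \sum_(x <- p) v (idx x) 0 = \sum_j (occ j p)%:R * v j 0.
Proof.
elim: p => [|x p IH]; first by rewrite big_nil big1 // => j _; rewrite mul0r.
rewrite big_cons IH (bigD1 (idx x)) //= [RHS](bigD1 (idx x)) //= eqxx natrD.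
rewrite mulrDl mul1r addrA; congr (_ + _); apply: eq_bigr => i ix.
by rewrite eq_sym (negbTE ix).
Qed.

Lemma sum_epath e : \sum_(x <- F e) v (idx x) 0 = lam * v (idx e) 0.
Proof.
have -> : lam * v (idx e) 0 = (A *m v) (idx e) 0 by rewrite Av mxE.
by rewrite sum_occ mxE; apply: eq_bigr => j _; rewrite occ_epath.
Qed.

Lemma sum_path_iter m e : \sum_(x <- path_iter f m e) v (idx x) 0 = lam ^+ m * v (idx e) 0.
Proof.
elim: m => [|m IH]; first by rewrite big_seq1 mul1r.
rewrite /path_iter /= -/(path_iter f m e) exprS -mulrA -IH big_flatten big_map /=.
by rewrite mulr_sumr; apply: eq_bigr => x _; rewrite sum_epath.
Qed.

(** The edges of the [k]-th image of [e] have total length [lam ^+ k] times that of [e]. For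
    [lam <= 1] this stays bounded, while their number does not and each has length at least [m]. *)
Lemma PF_eigenvalue_gt1 : 1 < lam.
Proof.
have [m m_gt0 mP] := positive_minimum v_gt0.
have lam0 : 0 <= lam.
  pose i := Ordinal orientation_gt0; rewrite -(pmulr_lge0 _ (v_gt0 i)).
  have -> : lam * v i 0 = (A *m v) i 0 by rewrite Av mxE.
  by rewrite mxE; apply: sumr_ge0 => j _; rewrite mulr_ge0 ?transition_matrix_ge0 // ltW.
have [e _] : exists e : gedge G, true by have /card_gt0P[e _] := gedge_gt0 G; exists e.
rewrite ltNge; apply/negP => lam1.
have [k kN] := path_iter_unbounded e (Num.truncn (v (idx e) 0 / m)).+1.
have : m * (size (path_iter f k e))%:R <= v (idx e) 0.
  apply: (@le_trans _ _ (\sum_(x <- path_iter f k e) v (idx x) 0)).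
    rewrite -sum1_size natr_sum mulr_sumr; apply: ler_sum => x _.
    by rewrite mulr1.
  by rewrite sum_path_iter ler_piMl ?exprn_ile1 // ltW.
rewrite mulrC -ler_pdivlMr // leNgt => /negP; apply.
apply: lt_le_trans (truncnS_gt _) _.
by rewrite ler_nat.
Qed.

End Lengths.

End Transitions.

(** * The natural coordinate *)


Section NaturalCoordinate.
Variables (R : realType) (G : tgraph R) (f : G -> G).
Hypotheses (f_map : graph_map f) (f_reg : regular_map f)
  (f_exp : expanding_on_all_scales f).
Variables (lam : R) (ell : gedge G -> R).
Hypotheses (lam_gt1 : 1 < lam) (ell_gt0 : forall e, 0 < ell e)
  (ell_ginv : forall e, ell (ginv e) = ell e)
  (ell_sum : forall e, \sum_(x <- epath f e) ell x = lam * ell e).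
Implicit Types (e x : gedge G) (u w a c : R) (Phi : gedge G -> R -> R).

Local Notation F := (epath f).
Local Notation q := (lam^-1).

(** Quantifying over all pieces, and not over a chosen subdivision, lets the property be tested on
    reversed edges and on the charts of any other metric structure. *)
Definition expands_along Phi := forall e a c e' g, 0 <= a -> c <= 1 ->
  piece (f \o gchar e) a c e' g ->
  forall u, a <= u <= c -> Phi e u = Phi e a + q * Phi e' (g u).

Lemma subdivision_exists : exists (t : gedge G -> nat -> R) (g : gedge G -> nat -> R -> R),
  forall e, [/\ t e 0 = 0, t e (size (F e)) = 1 & forall i, (i < size (F e))%N ->
      [/\ 0 <= t e i, t e i.+1 <= 1 &
          piece (f \o gchar e) (t e i) (t e i.+1) (nth e (F e) i) (g e i)]].
Proof.
have [f_cont _ _] := f_map.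
have H e : exists tg : (nat -> R) * (nat -> R -> R), [/\ tg.1 0 = 0, tg.1 (size (F e)) = 1 &
    forall i, (i < size (F e))%N -> [/\ 0 <= tg.1 i, tg.1 i.+1 <= 1 &
      piece (f \o gchar e) (tg.1 i) (tg.1 i.+1) (nth e (F e) i) (tg.2 i)]].
  have [t [g tg]] := edge_image_index f_cont (@epath_neq0 _ _ _ f_reg e) (epath_image f_map e).
  by exists (t, g).
have [tg tgP] := choice H.
by exists (fun e => (tg e).1), (fun e => (tg e).2).
Qed.

Lemma natural_coordinate : exists D : gedge G -> R -> R,
  [/\ forall e, ramp 0 1 (ell e) (D e), expands_along D &
      forall Phi, normalized ell Phi -> (forall e u, 0 <= Phi e u <= ell e) ->
        expands_along Phi -> forall e u, Phi e u = D e u].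
Proof.
have [t [g tgP]] := subdivision_exists.
have t0 e : t e 0 = 0 by case: (tgP e).
have t1 e : t e (size (F e)) = 1 by case: (tgP e).
have tg e i : (i < size (F e))%N ->
    piece (f \o gchar e) (t e i) (t e i.+1) (nth e (F e) i) (g e i).
  by move=> iF; have [_ _ /(_ i iF)[]] := tgP e.
have t_lt e i : (i < size (F e))%N -> t e i < t e i.+1 by move=> /tg[].
have gP e i : (i < size (F e))%N -> ramp (t e i) (t e i.+1) 1 (g e i) by move=> /tg[].
pose M := \sum_e ell e.
have ell_le e : ell e <= M.
  by rewrite /M (bigD1 e) //= lerDl; apply: sumr_ge0 => x _; exact: ltW.
have [D [D_flat D_homo D_cont DE]] :=
  fixpoint_exists lam_gt1 t0 t1 t_lt gP ell_gt0 ell_le ell_sum.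
have D_local : expands_along D.
  move=> e a c e' k a0 c1 P u uac; have [ac _ _] := P.
  (* The midpoint places the given piece in the chosen subdivision; by [piece_unique] it is one of
     its pieces. *)
  have mac : a < (a + c) / 2 < c by lra.
  have m01 : 0 <= (a + c) / 2 <= 1 by lra.
  have [i iF ti] := subdivision_locate t0 t1 e m01.
  have P' := tg e i iF.
  have [v1 v2] := piece_vert P'.
  have nv := piece_novert P mac.
  have tim : t e i < (a + c) / 2 < t e i.+1.
    rewrite !lt_neqAle; move/andP : ti => [-> ->]; rewrite !andbT.
    by apply/andP; split; apply/eqP => E; apply: nv; rewrite ?E // -E.
  have [aE cE e'E kg] := piece_unique P P' mac tim.
  have tu : t e i <= u <= t e i.+1 by rewrite -aE -cE.
  by have := pullback_local lam t_lt gP D_flat iF tu; rewrite -!DE e'E kg aE.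
exists D; split=> //; last first.
  move=> Phi Phi_flat Phi_rng Phi_local.
  apply: (normalized_fixpoint_unique lam_gt1 t0 t1 t_lt gP ell_le ell_sum) => //.
  - move=> e u; have [D0 D1] := D_flat e.
    rewrite -{1}(D0 (Num.min u 0)) ?ge_min ?lexx ?orbT //.
    rewrite D_homo ?ge_min ?lexx //=.
    by rewrite -(D1 (Num.max u 1)) ?le_max ?lexx ?orbT // D_homo ?le_max ?lexx.
  - apply: (normalized_fixpoint_of_local lam_gt1 t0 t1 t_lt gP ell_sum) => // e i u iF tu.
    have [_ _ /(_ i iF)[ti0 ti1 P]] := tgP e.
    exact: Phi_local ti0 ti1 P u tu.
move=> e; have [D0 D1] := D_flat e; split=> // u w u0 uw w1.
have D00 x : D x 0 = 0 by have [-> //] := D_flat x.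
have ch x : chain (scales q D (f \o gchar x) (D x)) 0 1 (F x).
  apply: chain_impl (epath_crosses f_map f_reg x) _ => a c y a0 c1 ac [k P].
  by exists k; split=> // z zac; exact: D_local P z zac.
(* Along the piece found in [[u, w]], [D e] gains [q ^+ m] times a positive length. *)
have [m [_ H]] := scale_piece f_exp e e u0 uw w1.
have Qcr a c e' : scales (q ^+ m) D (iter m f \o gchar e) (D e) a c e' ->
    crosses (iter m f \o gchar e) a c e' by move=> [k [P _]]; exists k.
have [a [c [e' [[ac ua cw] [k [P kD]] _ _]]]] :=
  H _ _ Qcr (iter_chain_scales D00 ch m e).
have [_ [_ _ k1 _ _] _] := P.
apply: (le_lt_trans (D_homo e _ _ ua)); apply: lt_le_trans (D_homo e _ _ cw).
rewrite (kD c); last by rewrite lexx ltW.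
have [_ D1'] := D_flat e'.
by rewrite k1 // D1' // ltrDl mulr_gt0 // exprn_gt0 // invr_gt0 (lt_trans ltr01).
Qed.

(* Both sides solve the fixed point equation that characterizes [D]. *)
Lemma natural_coordinate_ginv (D : gedge G -> R -> R) :
  (forall e, ramp 0 1 (ell e) (D e)) -> expands_along D ->
  (forall Phi, normalized ell Phi -> (forall e u, 0 <= Phi e u <= ell e) ->
        expands_along Phi -> forall e u, Phi e u = D e u) ->
  forall e u, D (ginv e) u = ell e - D e (1 - u).
Proof.
move=> D_ramp D_local D_unique.
pose Phi e u := ell e - D (ginv e) (1 - u).
have PhiD : forall e u, Phi e u = D e u.
  apply: D_unique.
  - move=> e; have [_ D0 D1 _ _] := D_ramp (ginv e); split=> u u01; rewrite /Phi.
      by rewrite D1 ?ell_ginv ?subrr //; lra.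
    by rewrite D0 ?subr0 //; lra.
  - move=> e u; have := ramp_range (D_ramp (ginv e)) (ltW (ell_gt0 _)) (1 - u).
    by rewrite /Phi ell_ginv; lra.
  - move=> e a c e' g a0 c1 P u uac; rewrite /Phi.
    have [ac [_ ga _ _ _] _] := P.
    have P' := piece_ginv a0 c1 P.
    have l0 : 0 <= 1 - c by lra.
    have l1 : 1 - a <= 1 by lra.
    have u' : 1 - c <= 1 - u <= 1 - a by lra.
    have a' : 1 - c <= 1 - a <= 1 - a by lra.
    rewrite (D_local _ _ _ _ _ l0 l1 P' _ u') (D_local _ _ _ _ _ l0 l1 P' _ a').
    rewrite !subKr (ga a) // subr0.
    have [_ _ D1 _ _] := D_ramp (ginv e'); rewrite (D1 1) // !ell_ginv; ring.
by move=> e u; rewrite -PhiD /Phi ginvK ell_ginv.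
Qed.

End NaturalCoordinate.

(** * Lengths in a metric structure *)


Section MetricStructures.
Variables (R : realType) (G : tgraph R).
Implicit Types (L : metric_structure G) (e : gedge G) (s t u : R).

Lemma isom_reparam_length (X : Type) (a b a' b' : R) (phi psi : R -> X) :
  a <= b -> a' <= b' -> isom_reparam a b phi a' b' psi -> b - a = b' - a'.
Proof.
move=> ab ab' [h [h_iso h_img _]].
have hI s : s \in `[a, b] -> h s \in `[a', b'].
  by move=> sab; have : (h @` `[a, b]) (h s) by [exists s]; rewrite h_img.
have aI : a \in `[a, b] by rewrite in_itv /= lexx.
have bI : b \in `[a, b] by rewrite in_itv /= lexx andbT.
have le1 : b - a <= b' - a'.
  rewrite -(ger0_norm (_ : 0 <= b - a)) ?subr_ge0 // -h_iso //.
  by have := hI _ aI; have := hI _ bI; rewrite !in_itv /= ler_norml; lra.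
have [s sI ha] : (h @` `[a, b]) a' by rewrite h_img /= in_itv /= lexx.
have [t tI hb] : (h @` `[a, b]) b' by rewrite h_img /= in_itv /= lexx andbT.
apply/eqP; rewrite eq_le le1 /=.
rewrite -(ger0_norm (_ : 0 <= b' - a')) ?subr_ge0 // -ha -hb h_iso //.
by move: sI tI; rewrite /= !in_itv /= ler_norml; lra.
Qed.

Lemma ms_length_ginv L e : ms_length L (ginv e) = ms_length L e.
Proof.
by rewrite /ms_length (isom_reparam_length _ _ (ms_inv L e)) // ltW // ms_lt.
Qed.

Lemma ms_length_gt0 L e : 0 < ms_length L e.
Proof. by rewrite subr_gt0 ms_lt. Qed.

Lemma ms_chart_cell L e s : ms_lo L e < s < ms_hi L e -> cell e (ms_chart L e s).
Proof.
move=> slh; have [_ [<- _ _] _ _] := ms_chartP L e.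
by exists s => //; rewrite /= in_itv.
Qed.

Lemma ms_chart_onto L e x : cell e x ->
  exists2 s, ms_lo L e < s < ms_hi L e & ms_chart L e s = x.
Proof.
have [_ [<- _ _] _ _] := ms_chartP L e => -[s + <-]; rewrite /= in_itv /=.
by exists s.
Qed.

Lemma ms_chart_inj L e s t : ms_lo L e < s < ms_hi L e ->
  ms_lo L e < t < ms_hi L e -> ms_chart L e s = ms_chart L e t -> s = t.
Proof.
move=> slh tlh st; have [_ [_ _ [k [_ kK]]] _ _] := ms_chartP L e.
by rewrite -(kK s) ?st ?kK //= in_itv.
Qed.

Lemma ms_chart_vert L e s : s = ms_lo L e \/ s = ms_hi L e -> gvert (ms_chart L e s).
Proof. by have [_ _ v0 v1] := ms_chartP L e; case=> ->. Qed.

Lemma ms_coordK L e s : ms_lo L e < s < ms_hi L e ->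
  ms_coord L e (ms_chart L e s) = s.
Proof.
move=> slh; rewrite /ms_coord; case: xgetP => [t _ [+ ts]|/(_ s)].
  by rewrite in_itv /= => tlh; exact: ms_chart_inj ts.
by case; split=> //; rewrite in_itv.
Qed.

Lemma ms_chart_end L e s : ms_lo L e <= s <= ms_hi L e ->
  ~ ms_lo L e < s < ms_hi L e -> s = ms_lo L e \/ s = ms_hi L e.
Proof.
move=> /andP[]; rewrite !le_eqVlt => /predU1P[->|ls]; first by left.
by move=> /predU1P[->|sh]; [right|rewrite ls sh].
Qed.

Lemma ms_chart_notin L e e' s : e <> e' -> e <> ginv e' ->
  ms_lo L e <= s <= ms_hi L e -> ~ cell e' (ms_chart L e s).
Proof.
move=> ee' ee'i slh xe'.
have [slh'|/(ms_chart_end slh)] := pselect (ms_lo L e < s < ms_hi L e).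
  by have [] := cell_eq xe' (ms_chart_cell slh').
by move=> /ms_chart_vert /(@gvert_cell _ _ e'); exact.
Qed.

Section Potential.
Variables (L : metric_structure G) (e : gedge G).

Let mid := (ms_lo L e + ms_hi L e) / 2.
Let half := (ms_hi L e - ms_lo L e) / 2.

(* A 1-Lipschitz function that drops by [half] from either end of [e] to its
   midpoint, so that the partition of [e] at its midpoint attains its length. *)
Definition potential (x : G) : R :=
  if `[< cell e x >] then `|ms_coord L e x - mid| else half.

Lemma potential_chart s : ms_lo L e <= s <= ms_hi L e ->
  potential (ms_chart L e s) = `|s - mid|.
Proof.
move=> slh; rewrite /potential; case: asboolP => [xe|nxe].
  congr (`|_ - _|); apply: ms_coordK; apply: contrapT => /(ms_chart_end slh).
  by move=> /ms_chart_vert /(@gvert_cell _ _ e); exact.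
have lh := ms_lt L e.
have [//|->|->] := ms_chart_end slh; first by move=> /ms_chart_cell.
  by rewrite /half /mid ler0_norm; lra.
by rewrite /half /mid ger0_norm; lra.
Qed.

(** The charts of [ginv e] and [e] differ by an isometry, and on every other closed edge, vertices
    included, the potential is constantly [half]. *)
Lemma potential_lipschitz e' s t : ms_lo L e' <= s <= ms_hi L e' ->
  ms_lo L e' <= t <= ms_hi L e' ->
  `|potential (ms_chart L e' s) - potential (ms_chart L e' t)| <= `|s - t|.
Proof.
move=> slh tlh.
have dist_lip x y : `| `|x - mid| - `|y - mid| | <= `|x - y|.
  by apply: le_trans (ler_dist_dist _ _) _; rewrite opprB addrA subrK.
have [e'e|e'e] := eqVneq e' e.
  by subst e'; rewrite !potential_chart.
have [e'i|e'i] := eqVneq e' (ginv e).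
  have [h [h_iso h_img hE]] := ms_inv L e'.
  rewrite e'i ginvK -e'i in h_img hE.
  have sI : s \in `[ms_lo L e', ms_hi L e'] by rewrite in_itv.
  have tI : t \in `[ms_lo L e', ms_hi L e'] by rewrite in_itv.
  have hI u : u \in `[ms_lo L e', ms_hi L e'] -> ms_lo L e <= h u <= ms_hi L e.
    move=> uI; have : (h @` `[ms_lo L e', ms_hi L e']) (h u) by exists u.
    by rewrite h_img /= in_itv.
  rewrite -(h_iso _ _ sI tI) !hE // !potential_chart; [exact: dist_lip|exact: hI|exact: hI].
have far u : ms_lo L e' <= u <= ms_hi L e' -> potential (ms_chart L e' u) = half.
  move=> ulh; rewrite /potential asboolF //.
  by apply: ms_chart_notin ulh; exact/eqP.
by rewrite !far // subrr normr0.
Qed.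

Lemma potential_path x y p : ms_path L x p y ->
  `|potential x - potential y| <= ms_path_length p.
Proof.
rewrite /ms_path_length; elim: p x => [x ->|[[e' s] t] p IH x].
  by rewrite big_nil subrr normr0.
move=> [sI tI <- /IH pth]; rewrite big_cons /=.
rewrite !in_itv /= in sI tI.
have := potential_lipschitz sI tI; rewrite (distrC s t) => lip.
apply: le_trans (lerD lip pth).
by rewrite -[X in `|X|](subrKA (potential (ms_chart L e' t))) ler_normD.
Qed.

Lemma potential_dist x y : (`|potential x - potential y|%:E <= ms_dist L x y)%E.
Proof.
apply: le_ereal_inf_tmp => _ [p /= pth <-]; rewrite lee_fin.
exact: potential_path.
Qed.

Lemma ms_dist_le s t : ms_lo L e <= s <= ms_hi L e ->
  ms_lo L e <= t <= ms_hi L e ->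
  (ms_dist L (ms_chart L e s) (ms_chart L e t) <= `|t - s|%:E)%E.
Proof.
move=> sI tI; apply: ereal_inf_lbound => /=; exists [:: (e, s, t)].
  by split; rewrite ?in_itv.
by rewrite /ms_path_length big_seq1.
Qed.

(** Segments of [e] bound the sums from above. From below the two ends of [e] do not suffice, as
    they may coincide or be joined by a shorter route; from the midpoint, however, either way out of
    [e] costs half its length. *)
Lemma dist_lengthE : dist_length L e = (ms_length L e)%:E.
Proof.
have lh := ms_lt L e.
apply/eqP; rewrite eq_le; apply/andP; split.
  apply: ge_ereal_sup => _ [s /= part <-].
  pose x i := nth 0 (ms_lo L e :: s) i.
  have [s_path s_last] := part.
  have x_lt i : (i < size s)%N -> x i < x i.+1.
    by move=> is_; have /(pathP 0) /(_ i is_) := s_path; rewrite /x /=; case: i is_.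
  have x_le i j : (i <= j)%N -> (j <= size s)%N -> x i <= x j.
    elim: j => [|j IH]; first by rewrite leqn0 => /eqP ->.
    rewrite leq_eqVlt => /predU1P[->//|ij] js.
    by apply: (le_trans (IH ij (ltnW js))); exact/ltW/x_lt.
  have x0 : x 0%N = ms_lo L e by [].
  have xn : x (size s) = ms_hi L e.
    by rewrite -(eqP s_last) /x -last_nth.
  have xI i : (i <= size s)%N -> ms_lo L e <= x i <= ms_hi L e.
    by move=> is_; rewrite -{1}x0 -xn !x_le.
  apply: (@le_trans _ _ (\sum_(i < size s) (x i.+1 - x i)%:E)%E).
    apply: lee_sum => i _.
    apply: le_trans (ms_dist_le (xI i (ltnW (ltn_ord i))) (xI i.+1 (ltn_ord i))) _.
    by rewrite ger0_norm // subr_ge0 ltW // x_lt.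
  by rewrite sumEFin -(big_mkord xpredT (fun i => x i.+1 - x i)) telescope_sumr // xn x0.
have midI : ms_lo L e <= mid <= ms_hi L e by rewrite /mid; lra.
have loI : ms_lo L e <= ms_lo L e <= ms_hi L e by rewrite lexx ltW.
have hiI : ms_lo L e <= ms_hi L e <= ms_hi L e by rewrite lexx ltW.
have part : itv_partition (ms_lo L e) (ms_hi L e) [:: mid; ms_hi L e].
  by split => //=; rewrite andbT /mid; apply/andP; split; lra.
apply: (@le_trans _ _ (ms_dist L (ms_chart L e (ms_lo L e)) (ms_chart L e mid) +
  ms_dist L (ms_chart L e mid) (ms_chart L e (ms_hi L e)))%E); last first.
  apply: ereal_sup_ubound; exists [:: mid; ms_hi L e] => //=.
  by rewrite !big_ord_recl big_ord0 adde0.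
apply: le_trans (leeD (potential_dist _ _) (potential_dist _ _)).
rewrite !potential_chart // -EFinD lee_fin subrr normr0 subr0 sub0r normrN !normr_id.
rewrite /ms_length /mid ler0_norm ?ger0_norm; lra.
Qed.

End Potential.

End MetricStructures.

(** * Existence of the metric structure *)


Section NaturalMetric.
Variables (R : realType) (G : tgraph R) (f : G -> G).
Hypotheses (f_map : graph_map f) (f_reg : regular_map f).
Variables (lam : R) (ell : gedge G -> R) (D : gedge G -> R -> R).
Hypotheses (lam_gt1 : 1 < lam) (ell_gt0 : forall e, 0 < ell e)
  (ell_ginv : forall e, ell (ginv e) = ell e)
  (D_ramp : forall e, ramp 0 1 (ell e) (D e))
  (D_local : expands_along f lam D)
  (D_ginv : forall e u, D (ginv e) u = ell e - D e (1 - u)).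
Implicit Types (e x : gedge G) (s u w a c : R).

(** The chart of [e] is its characteristic map precomposed with the inverse of [D e]. By [D_ginv],
    [s |-> ell e - s] is the isometry between the charts of [e] and [ginv e]. *)
Lemma natural_metric : exists L : metric_structure G, forall e,
  [/\ ms_lo L e = 0, ms_hi L e = ell e &
      forall u, 0 <= u <= 1 -> ms_chart L e (D e u) = gchar e u].
Proof.
have [k kP] := choice (fun e => ramp_inv (D_ramp e) ltr01).
pose chart e := echar e \o k e.
have D0 e : D e 0 = 0 by have [_ -> //] := D_ramp e.
have D1 e : D e 1 = ell e by have [_ _ -> //] := D_ramp e.
have chartD e u : 0 <= u <= 1 -> chart e (D e u) = gchar e u.
  by have [_ kK _ _] := kP e; move=> u01; rewrite /chart /= kK // echarE.
have chart_cont e : continuous (chart e).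
  have [k_cont _ _ _] := kP e.
  by move=> u; apply: continuous_comp; [exact: k_cont|exact: echar_continuous].
have inner e s : 0 < s < ell e -> exists2 u, 0 < u < 1 & D e u = s.
  move=> sl; have [|u u01 uE] := ramp_surj (D_ramp e) ltr01 (y := s); first lra.
  by exists u => //; apply: (ramp_inner_inv (D_ramp e)); rewrite uE.
have chartP e : char_map (@gvert R G) (cell e) 0 (ell e) (chart e).
  split; first exact: continuous_subspaceT.
  - split.
    + apply/seteqP; split=> [_ [s + <-]|x /cellP[u u01 <-]].
        rewrite /= in_itv /= => /inner[u u01 <-].
        by rewrite chartD; [exact: gchar_cell|lra].
      exists (D e u); last by apply: chartD; lra.
      by rewrite /= in_itv /=; exact: ramp_inner (D_ramp e) _ u01.
    + exact: continuous_subspaceT.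
    + have [gam [gam_cont gamK]] := gchar_coord e.
      have [_ _ _ _ D_cont] := D_ramp e.
      exists (D e \o gam); split; first exact: within_continuous_comp.
      move=> s; rewrite /= in_itv /= => /inner[u u01 <-].
      by rewrite chartD ?gamK //; lra.
  - by rewrite -(D0 e) chartD ?lexx ?ler01 //; apply: gchar_vert; left.
  - by rewrite -(D1 e) chartD ?lexx ?ler01 //; apply: gchar_vert; right.
have chart_inv e : isom_reparam 0 (ell e) (chart e) 0 (ell (ginv e)) (chart (ginv e)).
  exists (fun s => ell e - s); split.
  - by move=> s t _ _; rewrite opprB addrC addrA subrK distrC.
  - apply/seteqP; split=> [_ [s + <-]|s]; rewrite /= !in_itv /= ell_ginv => sl.
      lra.
    by exists (ell e - s); [rewrite in_itv /=; lra|exact: subKr].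
  - move=> s; rewrite in_itv /= => sl.
    have [u u01 <-] := ramp_surj (D_ramp e) ltr01 sl.
    rewrite chartD // -{2}(subKr 1 u) -D_ginv chartD; last lra.
    by rewrite gchar_ginv ?subKr //; lra.
exists (MetricStructure ell_gt0 chartP chart_inv) => e; split=> // u.
exact: chartD.
Qed.

Variable L : metric_structure G.
Hypothesis LP : forall e, [/\ ms_lo L e = 0, ms_hi L e = ell e &
  forall u, 0 <= u <= 1 -> ms_chart L e (D e u) = gchar e u].

Lemma natural_metric_coord e u : 0 < u < 1 -> ms_coord L e (gchar e u) = D e u.
Proof.
move=> u01; have [lo hi <-] := LP e; last lra.
by apply: ms_coordK; rewrite lo hi; exact: ramp_inner (D_ramp e) _ u01.
Qed.

(** The common source of linearity and homothety. As the ends of the affine interval go to vertices,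
    it contains every interval around [s] that is mapped onto an edge. The slope is negative when
    [e'] is opposite to the edge being crossed. *)
Lemma natural_metric_affine e e' s : 0 < s < ell e -> cell e' (f (ms_chart L e s)) ->
  exists a c al be, [/\ a < s < c, `|al| = lam, gvert (f (ms_chart L e a)),
    gvert (f (ms_chart L e c)) & forall z, a < z < c ->
      ms_coord L e' (f (ms_chart L e z)) = al * z + be].
Proof.
move=> sl e's; have [lo hi chartD] := LP e.
have sl' : 0 <= s <= ell e by lra.
have [u u01 uE] := ramp_surj (D_ramp e) ltr01 sl'.
have lam0 : 0 < lam by apply: lt_trans lam_gt1.
have [a [c [x [[a0 c1 ac uac] [g P] _]]]] :=
  chain_locate (epath_crosses f_map f_reg e) u01 ltr01.
have [va vc] := piece_vert P; have [_ gP gE] := P.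
have nvs : ~ gvert (f (gchar e u)).
  by rewrite -chartD // uE => /(@gvert_cell _ _ e'); exact.
have uac' : a < u < c.
  rewrite !lt_neqAle; move/andP : uac => [-> ->]; rewrite !andbT.
  by apply/andP; split; apply/eqP => E; apply: nvs; rewrite ?E // -E.
have [D_homo _ _ D_incr _] := D_ramp e.
have inv z : D e a < z < D e c -> exists2 w, a < w < c & D e w = z.
  move=> zac; have zl : 0 <= z <= ell e.
    have := ramp_range (D_ramp e) (ltW (ell_gt0 e)) a.
    have := ramp_range (D_ramp e) (ltW (ell_gt0 e)) c; lra.
  have [w w01 wE] := ramp_surj (D_ramp e) ltr01 zl; exists w => //.
  by apply/andP; split; rewrite ltNge; apply/negP => /D_homo; lra.
have DE w : a < w < c -> D x (g w) = lam * (D e w - D e a).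
  move=> wac; have wac' : a <= w <= c by lra.
  have := D_local a0 c1 P wac'.
  by move=> ->; rewrite addrAC subrr add0r mulVKf // gt_eqF.
have fchart w : a < w < c -> f (ms_chart L e (D e w)) = gchar x (g w).
  by move=> wac; rewrite chartD; [apply: gE|]; lra.
have e'x : e' = x \/ e' = ginv x.
  by apply: cell_eq (piece_inner P uac') _; rewrite /= -chartD // uE.
have suac : D e a < s < D e c by rewrite -uE !D_incr //; lra.
have va' : gvert (f (ms_chart L e (D e a))) by rewrite chartD //; lra.
have vc' : gvert (f (ms_chart L e (D e c))) by rewrite chartD //; lra.
have lamN : `|lam| = lam by rewrite gtr0_norm.
case: e'x => e'x; subst e'.
  exists (D e a), (D e c), lam, (- (lam * D e a)); split=> // _ /inv[w wac <-].
  rewrite fchart // natural_metric_coord ?DE //; first ring.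
  exact: ramp_inner wac.
exists (D e a), (D e c), (- lam), (ell x + lam * D e a); rewrite normrN.
split=> // _ /inv[w wac <-]; have gw := ramp_inner gP wac.
rewrite fchart // -{1}(subKr 1 (g w)) -gchar_ginv; last lra.
rewrite natural_metric_coord; last lra.
rewrite D_ginv subKr DE //; ring.
Qed.

Lemma natural_metric_linear : linear_wrt L f.
Proof.
move=> e e' c d; have [-> -> _] := LP e => c0 cd dl [fimg _ _].
have fcd s : c < s < d -> cell e' (f (ms_chart L e s)).
  by move=> scd; rewrite -fimg; exists (ms_chart L e s).
have fcd_vert s : gvert (f (ms_chart L e s)) -> ~ c < s < d.
  by move=> vs /fcd; exact: gvert_cell.
have mid : c < (c + d) / 2 < d by lra.
have midl : 0 < (c + d) / 2 < ell e by lra.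
have [a [b [al [be [mab _ va vb lin]]]]] := natural_metric_affine midl (fcd _ mid).
exists al, be => s; rewrite in_itv /= => scd; apply: lin.
have nva := fcd_vert _ va; have nvb := fcd_vert _ vb.
by apply/andP; split; rewrite ltNge; apply/negP => le;
  [apply: nva; lra|apply: nvb; lra].
Qed.

Lemma natural_metric_homothety : local_homothety L f lam.
Proof.
move=> e e' s; have [-> -> _] := LP e; rewrite in_itv /= => sl e's.
have [a [b [al [be [/andP[as_ sb] alE _ _ lin]]]]] := natural_metric_affine sl e's.
set K := fun u : R => ms_coord L e' (f (ms_chart L e u)).
have K_near : \near s, al * s + be = K s.
  near=> z; symmetry; apply: lin; apply/andP; split; near: z.
    exact: lt_nbhsr.
  exact: lt_nbhsl.
have dE : is_derive s 1 (fun z : R => al * z + be) al.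
  by apply: is_derive_eq; rewrite addr0 [LHS]mulr1.
split; first by apply: near_eq_derivable K_near _; exact: ex_derive.
rewrite derive1E -(near_eq_derive _ K_near).
by rewrite derive_val.
Unshelve. all: by end_near. Qed.

End NaturalMetric.

(** * Uniqueness of the metric structure *)


Section MetricUniqueness.
Variables (R : realType) (G : tgraph R).
Implicit Types (L : metric_structure G) (e x : gedge G) (s u w a c : R).

(* Position [y] along [e] has chart coordinate [al * y + be]: the chart may run in
   either direction. *)
Definition chart_end L e (al be : R) : Prop :=
  (al = 1 /\ be = ms_lo L e) \/ (al = -1 /\ be = ms_hi L e).

(** The change from [gchar e] to a chart is a continuous injection of an interval, hence strictly
    monotone. In the decreasing case the coordinate is measured from [ms_hi L e], so that [d] always
    increases. *)
Lemma chart_rampP L e : exists (d : R -> R) (al be : R),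
  [/\ ramp 0 1 (ms_length L e) d, chart_end L e al be &
      forall u, 0 <= u <= 1 -> ms_chart L e (al * d u + be) = gchar e u].
Proof.
have lh := ms_lt L e.
have [ccont [_ _ [gam [gam_cont gamK]]] _ _] := ms_chartP L e.
pose sig := gam \o echar e.
have sigP u : 0 < u < 1 ->
    ms_lo L e < sig u < ms_hi L e /\ ms_chart L e (sig u) = gchar e u.
  move=> u01; have [s slh sE] := ms_chart_onto L (gchar_cell e u01).
  have -> : sig u = s by rewrite /sig /= echarE -?sE; [apply: gamK; rewrite /= in_itv|lra].
  by [].
have sig_onto s : ms_lo L e < s < ms_hi L e -> exists2 u, 0 < u < 1 & sig u = s.
  move=> slh; have /cellP[u u01 uE] := ms_chart_cell slh.
  exists u => //; have [su sE] := sigP u u01.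
  by apply: ms_chart_inj slh _; rewrite // sE.
have sig_cont : {within `]0, 1[%classic, continuous sig}.
  apply: (@within_comp _ _ _ _ (cell e)) => //.
    exact/continuous_subspaceT/echar_continuous.
  move=> u; rewrite /= in_itv /= => u01; rewrite echarE; last lra.
  exact: gchar_cell.
have sig_inj : {in `]0, 1[ &, injective sig}.
  move=> u w; rewrite !in_itv /= => u01 w01 uw; apply: (@gchar_inj _ _ e) => //.
  by have [_ <-] := sigP u u01; have [_ <-] := sigP w w01; rewrite uw.
pose chart := ms_chart L e \o clamp (ms_lo L e) (ms_hi L e).
have chart_cont : continuous chart by apply: within_clamp_continuous; first exact: ltW.
have closing (d : R -> R) al be : ramp 0 1 (ms_length L e) d -> chart_end L e al be ->
    (forall u, 0 < u < 1 -> al * d u + be = sig u) ->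
    forall u, 0 <= u <= 1 -> ms_chart L e (al * d u + be) = gchar e u.
  move=> d_ramp end_ dE u u01.
  have d_rng z := ramp_range d_ramp (ltW (ms_length_gt0 L e)) z.
  have rng z : ms_lo L e <= al * d z + be <= ms_hi L e.
    by have := d_rng z; rewrite /ms_length; case: end_ => -[-> ->]; lra.
  rewrite -(clamp_id (rng u)) -(echarE _ u01) -[LHS]/((chart \o (fun z => al * d z + be)) u).
  apply: (@continuous_eq_segment R G _ _ 0 1) => //.
  - exact: ghausdorff.
  - move=> z; apply: continuous_comp; last exact: chart_cont.
    have [_ _ _ _ d_cont] := d_ramp.
    apply: cvgD; last exact: cvg_cst.
    by apply: cvgM; [exact: cvg_cst|exact: d_cont].
  - exact: echar_continuous.
  - move=> z z01; have [szl szE] := sigP z z01.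
    by rewrite /chart /= dE // clamp_id ?szE ?echarE //; lra.
have [sig_mono|sig_mono] := itv_continuous_inj_mono sig_cont sig_inj.
  have lt_mono u w : 0 < u -> u < w -> w < 1 -> sig u < sig w.
    move=> u0 uw w1; have uI : u \in `]0, 1[ by rewrite in_itv /=; lra.
    have wI : w \in `]0, 1[ by rewrite in_itv /=; lra.
    exact: sig_mono.
  have [|||d [d_ramp dE]] := @ramp_extend R 0 1 (ms_length L e)
      (fun u => sig u - ms_lo L e) ltr01 (ms_length_gt0 L e).
  - by move=> u w u0 uw w1; rewrite ltrD2r lt_mono.
  - by move=> u /sigP[]; rewrite /ms_length; lra.
  - move=> y yl; have [|u u01 uE] := sig_onto (y + ms_lo L e).
      by move: yl; rewrite /ms_length; lra.
    by exists u => //; rewrite uE addrK.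
  have end_ : chart_end L e 1 (ms_lo L e) by left.
  exists d, 1, (ms_lo L e); split=> //; apply: closing => // u u01.
  by rewrite dE // mul1r subrK.
have lt_mono u w : 0 < u -> u < w -> w < 1 -> sig w < sig u.
  move=> u0 uw w1; have uI : u \in `]0, 1[ by rewrite in_itv /=; lra.
  have wI : w \in `]0, 1[ by rewrite in_itv /=; lra.
  exact: sig_mono.
have [|||d [d_ramp dE]] := @ramp_extend R 0 1 (ms_length L e)
    (fun u => ms_hi L e - sig u) ltr01 (ms_length_gt0 L e).
- by move=> u w u0 uw w1; rewrite ltrD2l ltrN2 lt_mono.
- by move=> u /sigP[]; rewrite /ms_length; lra.
- move=> y yl; have [|u u01 uE] := sig_onto (ms_hi L e - y).
    by move: yl; rewrite /ms_length; lra.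
  by exists u => //; rewrite uE subKr.
have end_ : chart_end L e (-1) (ms_hi L e) by right.
exists d, (-1), (ms_hi L e); split=> //; apply: closing => // u u01.
by rewrite dE // mulN1r opprB subrK.
Qed.

Variables (f : G -> G) (lam : R) (L : metric_structure G).
Hypotheses (f_map : graph_map f) 
  (f_lin : linear_wrt L f) (f_hom : local_homothety L f lam).
Variables (d : gedge G -> R -> R) (al be : gedge G -> R).
Hypotheses (d_ramp : forall e, ramp 0 1 (ms_length L e) (d e))
  (ends : forall e, chart_end L e (al e) (be e))
  (chartE : forall e u, 0 <= u <= 1 -> ms_chart L e (al e * d e u + be e) = gchar e u).

(** Linearity gives a slope [p] in the charts, and homothety [|p| = lam]. In the increasing
    coordinates [d] the slope is [k], that is [p] times two signs; it is positive because lengths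
    are, so [k = lam] whatever the directions. *)
Lemma linear_homothety_expands_along : expands_along f lam d.
Proof.
move=> e a c e' g a0 c1 P.
have [f_cont _ _] := f_map.
have [ac gP gE] := P.
have al2 x : al x * al x = 1 by case: (ends x) => -[-> _]; rewrite ?mulrNN mulr1.
have [d_homo d0 d1 d_incr d_cont] := d_ramp e.
have lo_hi : ms_hi L e = ms_lo L e + ms_length L e by rewrite /ms_length addrC subrK.
have d_rng z := ramp_range (d_ramp e) (ltW (ms_length_gt0 L e)) z.
have onto y : d e a < y < d e c -> exists2 u, a < u < c & d e u = y.
  move=> yac; have yl : 0 <= y <= ms_length L e.
    by have := d_rng a; have := d_rng c; lra.
  have [u u01 uE] := ramp_surj (d_ramp e) ltr01 yl; exists u => //.
  by apply/andP; split; rewrite ltNge; apply/negP => /d_homo; lra.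
have dac : d e a < d e c by apply: d_incr; lra.
(* The piece in the chart coordinate of [e]; [s0] corresponds to [c] when the chart runs
   backwards. *)
have [s0 [s1 [[ls0 s01 s1h] s_in s_out]]] : exists s0 s1,
  [/\ [/\ ms_lo L e <= s0, s0 < s1 & s1 <= ms_hi L e],
      forall u, a < u < c -> s0 < al e * d e u + be e < s1 &
      forall s, s0 < s < s1 -> exists2 u, a < u < c & al e * d e u + be e = s].
  have := d_rng a; have := d_rng c.
  have mono u : a < u < c -> d e a < d e u < d e c.
    by move=> uac; rewrite !d_incr //; lra.
  case: (ends e) => -[-> ->] dc da.
    exists (d e a + ms_lo L e), (d e c + ms_lo L e); split; first by split; lra.
      by move=> u /mono; lra.
    move=> s sI; have [|u uac uE] := onto (s - ms_lo L e); first lra.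
    by exists u => //; rewrite uE mul1r subrK.
  exists (ms_hi L e - d e c), (ms_hi L e - d e a); split; first by split; lra.
    by move=> u /mono; lra.
  move=> s sI; have [|u uac uE] := onto (ms_hi L e - s); first lra.
  by exists u => //; rewrite uE mulN1r opprB subrK.
have homeo : homeo_on (ms_chart L e @` `]s0, s1[) (cell e') f.
  have -> : ms_chart L e @` `]s0, s1[ = gchar e @` `]a, c[.
    apply/seteqP; split=> [_ [s + <-]|_ [u + <-]]; rewrite /= in_itv /=.
      move=> /s_out[u uac <-]; exists u; first by rewrite /= in_itv.
      by rewrite chartE //; lra.
    move=> uac; exists (al e * d e u + be e); last by apply: chartE; lra.
    by rewrite /= in_itv /=; exact: s_in.
  exact: piece_homeo P.
have [p [r lin]] := f_lin ls0 s01 s1h homeo.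
have coordE w : 0 < w < 1 -> ms_coord L e' (gchar e' w) = al e' * d e' w + be e'.
  move=> w01; rewrite -chartE; last lra.
  apply: ms_coordK; have := ramp_inner (d_ramp e') w01.
  by rewrite /ms_length; case: (ends e') => -[-> ->]; lra.
have p_lam : `|p| = lam.
  pose s := (s0 + s1) / 2.
  have sI : s0 < s < s1 by rewrite /s; lra.
  have slh : s \in `]ms_lo L e, ms_hi L e[ by rewrite in_itv /=; lra.
  have cell_s : cell e' (f (ms_chart L e s)).
    by have [<- _ _] := homeo; exists (ms_chart L e s).
  have [_ <-] := f_hom slh cell_s.
  have K_near : \near s, p * s + r = ms_coord L e' (f (ms_chart L e s)).
    near=> z; symmetry; apply: lin; rewrite in_itv /=; apply/andP; split; near: z.
      by apply: lt_nbhsr; case/andP: sI.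
    by apply: lt_nbhsl; case/andP: sI.
  have dE : is_derive s 1 (fun z : R => p * z + r) p.
    by apply: is_derive_eq; rewrite addr0 [LHS]mulr1.
  by rewrite derive1E -(near_eq_derive _ K_near) derive_val.
pose k := al e' * p * al e.
pose r' := al e' * (p * be e + r - be e').
have open_eq u : a < u < c -> d e' (g u) = k * d e u + r'.
  move=> uac; have uac' : a <= u <= c by lra.
  have := lin (al e * d e u + be e); rewrite in_itv /= s_in // chartE; last lra.
  have -> : f (gchar e u) = gchar e' (g u) by exact: gE.
  rewrite coordE; last exact: ramp_inner uac.
  move=> /(_ isT) H; rewrite -[LHS]mul1r -(al2 e') -mulrA.
  have -> : al e' * d e' (g u) = p * (al e * d e u + be e) + r - be e'.
    by rewrite -H addrK.
  by rewrite /k /r'; ring.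
have closed_eq u : a <= u <= c -> d e' (g u) = k * d e u + r'.
  have [_ _ _ _ d'_cont] := d_ramp e'; have [_ _ _ _ g_cont] := gP.
  apply: (@continuous_eq_segment R R (d e' \o g) (fun u => k * d e u + r')) => //.
  - by move=> z; apply: continuous_comp; [exact: g_cont|exact: d'_cont].
  - move=> z; apply: cvgD; last exact: cvg_cst.
    by apply: cvgM; [exact: cvg_cst|exact: d_cont].
(* Evaluation at both ends, where [g] is 0 and 1, fixes [r'] and the sign of [k]. *)
have [_ g0 g1 _ _] := gP.
have [_ d'0 d'1 _ _] := d_ramp e'.
have at_a : 0 = k * d e a + r'.
  by rewrite -closed_eq ?lexx ?ltW // (g0 a) // d'0.
have at_c : ms_length L e' = k * d e c + r'.
  by rewrite -closed_eq ?lexx ?ltW // (g1 c) // d'1.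
have k_gt0 : 0 < k.
  have : 0 < k * (d e c - d e a).
    have -> : k * (d e c - d e a) = ms_length L e' by rewrite at_c mulrBr; lra.
    exact: ms_length_gt0.
  by rewrite pmulr_lgt0 // subr_gt0.
have kE : k = lam.
  rewrite -p_lam -(gtr0_norm k_gt0) /k !normrM.
  have al1 x : `|al x| = 1 by case: (ends x) => -[-> _]; rewrite ?normrN normr1.
  by rewrite !al1 mulr1 mul1r.
move=> u uac; rewrite closed_eq // -kE.
have -> : k * d e u + r' = k * (d e u - d e a) by rewrite mulrBr; lra.
by rewrite mulKf ?gt_eqF // addrC subrK.
Unshelve. all: by end_near. Qed.

(** As [al e] is a sign, [s |-> al e * (s - be e)] inverts the position formula and is an isometry
    onto the chart interval of [L0]. *)
Lemma same_ramp_equiv (L0 : metric_structure G) (D : gedge G -> R -> R) :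
  (forall e, [/\ ms_lo L0 e = 0, ms_hi L0 e = ms_length L e &
     forall u, 0 <= u <= 1 -> ms_chart L0 e (D e u) = gchar e u]) ->
  (forall e u, d e u = D e u) -> ms_equiv L L0.
Proof.
move=> L0P dD e; have [-> -> chart0] := L0P e.
have lo_hi : ms_hi L e = ms_lo L e + ms_length L e by rewrite /ms_length addrC subrK.
have [al1 al2] : `|al e| = 1 /\ al e * al e = 1.
  by case: (ends e) => -[-> _]; rewrite ?normrN normr1 ?mulrNN mulr1.
have hI s : ms_lo L e <= s <= ms_hi L e -> 0 <= al e * (s - be e) <= ms_length L e.
  by rewrite lo_hi; case: (ends e) => -[-> ->]; rewrite ?lo_hi; lra.
exists (fun s => al e * (s - be e)); split.
- move=> s t _ _; rewrite -mulrBr normrM al1 mul1r; congr (`|_|); ring.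
- apply/seteqP; split=> [_ [s + <-]|y]; rewrite /= !in_itv /=; first exact: hI.
  move=> yl; exists (al e * y + be e); last by rewrite addrK mulrA al2 mul1r.
  by rewrite /= in_itv /= lo_hi; case: (ends e) => -[-> ->]; rewrite ?lo_hi; lra.
- move=> s; rewrite in_itv /= => /hI sl.
  have [u u01 uE] := ramp_surj (d_ramp e) ltr01 sl.
  rewrite -uE dD chart0 // -chartE // uE mulrA al2 mul1r subrK //.
Qed.

End MetricUniqueness.

Unset Implicit Arguments.

Theorem theoremA3 (R : realType) (G : tgraph R) (f : G -> G)
    (f_map : graph_map f) (f_reg : regular_map f)
    (f_exp : expanding_on_all_scales f)
    (Ep : {set gedge G}) (Ep_or : orientation Ep)
    (n : nat) (e_ : 'I_n -> gedge G) (e_inj : injective e_)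
    (e_Ep : forall e, (e \in Ep) = (e \in codom e_)) :
  let A := transition_matrix f e_ in
  let lam := spectral_radius A in
  [/\ expanding f, irreducible_mx A, 1 < lam &
      exists v : 'cV[R]_n,
        [/\ PF_eigenvector A v,
            forall w : 'cV[R]_n, PF_eigenvector A w -> w = v &
            let good (L : metric_structure G) :=
              [/\ volume L Ep = 1,
                  linear_wrt L f,
                  local_homothety L f lam &
                  forall i : 'I_n, dist_length L (e_ i) = (v i 0)%:E] in
            exists L : metric_structure G,
              good L /\ forall L', good L' -> ms_equiv L' L]].
Proof.
move=> A lam.
have [idx idxE] := edge_index_exists Ep_or e_inj e_Ep.
have A_ge0 := transition_matrix_ge0 f idxE.
have A_irr : irreducible_mx A := transition_matrix_irreducible f_map f_reg f_exp idxE.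
have n_gt0 := orientation_gt0 idx.
have [r [v [r0 v_gt0 Av v1]]] := PF_eigenvector_exists A_ge0 A_irr n_gt0.
have lamE : lam = r := spectral_radius_PF n_gt0 A_ge0 v_gt0 Av.
rewrite -{}lamE {r r0} in Av.
have lam_gt1 : 1 < lam := PF_eigenvalue_gt1 f_map f_reg f_exp idxE v_gt0 Av.
split=> //; first exact: regular_expanding.
exists v; split; first by [].
  move=> w [w_gt0 Aw w1].
  exact: (PF_eigenvector_unique A_ge0 A_irr v_gt0 Av v1 w_gt0 Aw w1).
move=> good.
pose ell e := v (idx e) 0.
have ell_gt0 e : 0 < ell e by exact: v_gt0.
have ell_ginv e : ell (ginv e) = ell e by rewrite /ell (idx_ginv idxE).
have ell_sum e : \sum_(x <- epath f e) ell x = lam * ell e.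
  exact: (sum_epath f_map f_reg idxE Av).
have [D [D_ramp D_local D_unique]] :=
  natural_coordinate f_map f_reg f_exp lam_gt1 ell_gt0 ell_sum.
have D_ginv := natural_coordinate_ginv ell_gt0 ell_ginv D_ramp D_local D_unique.
have [L LP] := natural_metric ell_gt0 ell_ginv D_ramp D_ginv.
have L_length e : ms_length L e = ell e.
  by have [lo hi _] := LP e; rewrite /ms_length lo hi subr0.
exists L; split.
  split.
  - rewrite -v1 /volume (eq_bigl (fun e => e \in codom e_)) // -big_uniq /=; last first.
      by rewrite map_inj_uniq ?enum_uniq.
    rewrite big_map big_enum /=; apply: eq_bigr => i _.
    by rewrite L_length /ell (idx_e_ idxE).
  - exact: (natural_metric_linear f_map f_reg lam_gt1 ell_gt0 D_ramp D_local D_ginv LP).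
  - exact: (natural_metric_homothety f_map f_reg lam_gt1 ell_gt0 D_ramp D_local D_ginv LP).
  - by move=> i; rewrite dist_lengthE L_length /ell (idx_e_ idxE).
move=> L' [_ L'_lin L'_hom L'_dist].
(* Property (3) fixes the lengths on the chosen orientation; inverse edges have the same length. *)
have L'_length e : ms_length L' e = ell e.
  have H i : ms_length L' (e_ i) = v i 0.
    by have := L'_dist i; rewrite dist_lengthE => -[].
  by rewrite /ell; case: (idx_cases idxE e) => {1}->; rewrite ?ms_length_ginv H.
have cex e : exists c : (R -> R) * (R * R), [/\ ramp 0 1 (ms_length L' e) c.1,
    chart_end L' e c.2.1 c.2.2 & forall u, 0 <= u <= 1 ->
      ms_chart L' e (c.2.1 * c.1 u + c.2.2) = gchar e u].
  by have [d [al [be dP]]] := chart_rampP L' e; exists (d, (al, be)).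
have [c cP] := choice cex.
pose d e := (c e).1; pose al e := (c e).2.1; pose be e := (c e).2.2.
have d_ramp e : ramp 0 1 (ms_length L' e) (d e) by case: (cP e).
have ends e : chart_end L' e (al e) (be e) by case: (cP e).
have chartE e u : 0 <= u <= 1 -> ms_chart L' e (al e * d e u + be e) = gchar e u.
  by case: (cP e) => _ _; exact.
apply: (same_ramp_equiv d_ramp ends chartE (D := D)).
  by move=> e; have [lo hi chartD] := LP e; rewrite L'_length.
(* What remains is that the coordinates [d] of [L'] have the properties that determine [D]. *)
apply: D_unique.
- move=> e; have [_ d0 d1 _ _] := d_ramp e; split=> u u01; first exact: d0.
  by rewrite d1 // L'_length.
- move=> e u; rewrite -L'_length; apply: (ramp_range (d_ramp e)).
  by rewrite ltW // ms_length_gt0.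
- exact: (linear_homothety_expands_along f_map L'_lin L'_hom d_ramp ends chartE).
Qed.
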